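(* There exists a Cantor set $X$ in $\mathbb{C}^3$ such that $\widehat{X}\setminus X\neq\emptyset$ and the uniform algebra $P(X)$ has dense invertibles.
   Context: For a compact set $X\subset\mathbb{C}^N$, the polynomial hull is $\widehat{X}=\{z\in\mathbb{C}^N: |p(z)|\le \max_{x\in X}|p(x)| \text{ for all polynomials } p\}$. $P(X)$ denotes the uniform closure on $X$ of the polynomials in the complex coordinate functions $z_1,\dots,z_N$, a closed subalgebra of $C(X)$ with the supremum norm. A uniform algebra $A$ has dense invertibles if the set of invertible elements of $A$ is dense in $A$. *)

(* Defs.v *)
From Stdlib Require Import Reals.
Open Scope R_scope.

Definition Cx : Type := (R * R)%type.
Definition Cadd (a b : Cx) : Cx := (fst a + fst b, snd a + snd b).
Definition Cmul (a b : Cx) : Cx :=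
  (fst a * fst b - snd a * snd b, fst a * snd b + snd a * fst b).
Definition Csub (a b : Cx) : Cx := (fst a - fst b, snd a - snd b).
Definition Cone : Cx := (1, 0).
Definition Cmod (a : Cx) : R := sqrt (fst a ^ 2 + snd a ^ 2).

Definition C3 : Type := (Cx * Cx * Cx)%type.
Definition coord (i : nat) (z : C3) : Cx :=
  match i with
  | 0%nat => fst (fst z)
  | 1%nat => snd (fst z)
  | _ => snd z
  end.
Definition dist3 (z w : C3) : R :=
  sqrt (Cmod (Csub (coord 0 z) (coord 0 w)) ^ 2
      + Cmod (Csub (coord 1 z) (coord 1 w)) ^ 2
      + Cmod (Csub (coord 2 z) (coord 2 w)) ^ 2).

Inductive poly3 : Type :=
  | PConst : Cx -> poly3
  | PVar : nat -> poly3          (* PVar 0, PVar 1, PVar 2 = z1, z2, z3 *)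
  | PAdd : poly3 -> poly3 -> poly3
  | PMul : poly3 -> poly3 -> poly3.

Fixpoint peval (p : poly3) (z : C3) : Cx :=
  match p with
  | PConst c => c
  | PVar i => coord i z
  | PAdd p q => Cadd (peval p z) (peval q z)
  | PMul p q => Cmul (peval p z) (peval q z)
  end.

(** A Cantor set in C^3: a subset homeomorphic to the Cantor space {0,1}^N
    (product topology), which is homeomorphic to the middle-thirds set. *)
Definition cantor_set (X : C3 -> Prop) : Prop :=
  exists (f : (nat -> bool) -> C3) (g : C3 -> (nat -> bool)),
    (forall s, X (f s)) /\
    (forall s, g (f s) = s) /\
    (forall x, X x -> f (g x) = x) /\
    (forall s (eps : R), 0 < eps -> exists N : nat, forall t,
        (forall n, (n < N)%nat -> t n = s n) -> dist3 (f s) (f t) < eps) /\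
    (forall x, X x -> forall N : nat, exists delta, 0 < delta /\
        forall y, X y -> dist3 x y < delta ->
          forall n, (n < N)%nat -> g y n = g x n).

Definition poly_hull (X : C3 -> Prop) (z : C3) : Prop :=
  forall (p : poly3) (M : R),
    (forall x, X x -> Cmod (peval p x) <= M) -> Cmod (peval p z) <= M.

(** Membership in P(X): uniform limit on X of polynomials
    (functions are identified when they agree on X). *)
Definition in_PX (X : C3 -> Prop) (f : C3 -> Cx) : Prop :=
  forall eps : R, 0 < eps -> exists p : poly3,
    forall x, X x -> Cmod (Csub (f x) (peval p x)) < eps.

Definition invertible_PX (X : C3 -> Prop) (g : C3 -> Cx) : Prop :=
  in_PX X g /\ exists h, in_PX X h /\ forall x, X x -> Cmul (g x) (h x) = Cone.

Definition dense_invertibles_PX (X : C3 -> Prop) : Prop :=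
  forall f, in_PX X f -> forall eps : R, 0 < eps ->
    exists g, invertible_PX X g /\
      forall x, X x -> Cmod (Csub (f x) (g x)) < eps.

(* Main.v *)
(** A curve [p = q = 0] in C^3 can be followed from any of its points in a direction in
    which a given linear form increases, so it leaves every bounded set at a larger value
    of that form.  Applied to the tangent forms of a strictly convex paraboloid, this shows
    that a curve crossing a small convex cap of the paraboloid also crosses slightly raised,
    pairwise disjoint smaller caps covering the given one.  Iterating, one obtains a Cantor
    set Y (the graph, over the paraboloid, of a space-filling map of a very thin Cantor set)
    that meets every algebraic curve through the point [base_point] below the paraboloid.

    Hence, for every polynomial [f] with [f = 1] at [base_point], each polynomial takes its
    value at [base_point] also on [Y ∩ {f = 1}].  Running through a dense sequence [e_k] of
    polynomials, put [f_{k+1} = c e_k (1 + (f_k - 1)/m)^n] with [f_{k+1} = 1] at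
    [base_point] and [m, n] large: then [Re f_{k+1} >= 1/2] implies [Re f_k >= 1/2] on Y,
    and it makes [f_{k+1}], hence [e_k], invertible.  The points of Y with
    [Re f_k >= 1/2] for all [k] form a set with nontrivial hull and dense invertibles, and
    a minimal closed subset with the same hull property is perfect. *)
From Stdlib Require Import Reals Lra Lia Psatz List ZArith Arith.
From Stdlib Require Import Classical ClassicalEpsilon FunctionalExtensionality.
From Stdlib Require Cantor.
From mathcomp Require all_boot all_order all_algebra Rstruct complex.
From Coquelicot Require Import Coquelicot.
Require Import Defs.
Open Scope R_scope.

(** Following an arbitrary algebraic curve would need its dimension theory and local
    parametrizations. Instead [p] and [q] are replaced by [p + eta z3^D] and [q + eta z2^D] with [D]
    above both degrees. On the perturbed zero set every linear form with nonzero [z1]-coefficient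
    has bounded, finite fibres, and resultants together with continuity of roots give enough local
    continuation. Only zeros on the compact set Y are wanted in the end, so letting [eta] tend to 0
    removes the perturbation.

    Three variables are used because two equations can then be imposed at once: [f = 1] for the
    current peak and [q = 0] for an arbitrary polynomial.

    The caps shrink because raising a level costs little: at stage [n] squared radii are [4^-n], the
    rise is at most [4^-n / 12], and the nearest of the new centres is within squared distance
    [5/64 * 4^-n]. Their sum is below [4^-(n+1)]. *)

Fixpoint PPow (p : poly3) (n : nat) : poly3 :=
  match n with
  | O => PConst Cone
  | S n => PMul p (PPow p n)
  end.

Fixpoint pdeg (p : poly3) : nat :=
  match p with
  | PConst _ => 0
  | PVar _ => 1
  | PAdd p q => Nat.max (pdeg p) (pdeg q)
  | PMul p q => pdeg p + pdeg q
  end.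

(** With [D] above the degree of [p], the monomial [z_i^D] dominates wherever [z_i] is the largest
    coordinate. The constant [k] can be chosen to make the added term vanish at a prescribed
    point. *)
Definition perturb (i D : nat) (eta k : Cx) (p : poly3) : poly3 :=
  PAdd p (PMul (PConst eta) (PAdd (PPow (PVar i) D) (PConst k))).

Definition Czero : Cx := (0, 0).

Definition lin (al be ga : Cx) (z : C3) : Cx :=
  Cadd (Cmul al (coord 0 z)) (Cadd (Cmul be (coord 1 z)) (Cmul ga (coord 2 z))).

Definition common_zero (p q : poly3) (z : C3) : Prop :=
  peval p z = Czero /\ peval q z = Czero.

(** * Projection of perturbed curves by resultants *)

Module Elimination.
Import HB.structures all_boot all_order all_algebra Rstruct complex.
Import Order.TTheory GRing.Theory Num.Theory.
Local Open Scope ring_scope.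

Local Notation C := (R[i]).
Definition toC (z : Cx) : C := Complex (fst z) (snd z).
Definition ofC (z : C) : Cx := (complex.Re z, complex.Im z).

Lemma toCK z : ofC (toC z) = z. Proof. by case: z. Qed.
Lemma ofCK z : toC (ofC z) = z. Proof. by case: z. Qed.
Lemma toC_inj a b : toC a = toC b -> a = b.
Proof. by move=> /(congr1 ofC); rewrite !toCK. Qed.

Lemma toC_add a b : toC (Cadd a b) = toC a + toC b.
Proof. by case: a => a1 a2; case: b. Qed.
Lemma toC_mul a b : toC (Cmul a b) = toC a * toC b.
Proof. by case: a => a1 a2; case: b. Qed.
Lemma toC_sub a b : toC (Csub a b) = toC a - toC b.
Proof. by case: a => a1 a2; case: b. Qed.
Lemma toC_one : toC Cone = 1. Proof. by []. Qed.
Lemma toC_zero : toC Czero = 0. Proof. by []. Qed.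

Lemma toC_norm (a : Cx) : `|toC a| = Complex (Cmod a) 0.
Proof.
case: a => a1 a2; rewrite normc_def /=; congr (Complex _ _).
by rewrite /Cmod RsqrtE !RpowE.
Qed.

Section Param.
Variables (al be ga mu : C).
Hypotheses (al0 : al != 0) (mu0 : mu != 0).

Local Notation K := ({poly {poly C}}).

Definition cst (k : C) : {poly K} := k%:P%:P%:P.
(** The coordinates [z3], [z2], [z1] are rewritten in the new variables [a = al z1 + be z2 + ga z3],
    [b = z2 + mu z3], [c = z3]. In [{poly K}] the outermost variable is [c], the one to be
    eliminated; then come [b] and, innermost, [a]. *)
Definition v3 : {poly K} := 'X.
Definition v2 : {poly K} := 'X%:P - cst mu * 'X.
Definition v1 : {poly K} := cst al^-1 * (('X%:P)%:P - cst be * v2 - cst ga * v3).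

Fixpoint tri (p : poly3) : {poly K} :=
  match p with
  | PConst c => cst (toC c)
  | PVar 0 => v1
  | PVar 1 => v2
  | PVar _ => v3
  | PAdd p q => tri p + tri q
  | PMul p q => tri p * tri q
  end.

Definition ev2 (a b : C) : {rmorphism K -> C} :=
  (horner_eval a \o horner_eval (b%:P : {poly C}))%FUN.

Definition pt (a b c : C) : C3 :=
  (ofC (al^-1 * (a - be * (b - mu * c) - ga * c)), ofC (b - mu * c), ofC c).

Definition ev3 (a b c : C) : {rmorphism {poly K} -> C} :=
  (horner_eval c \o map_poly (ev2 a b))%FUN.

Lemma ev3_cst a b c k : ev3 a b c (cst k) = k.
Proof. by rewrite /ev3 /= /cst map_polyC /= /horner_eval !hornerC. Qed.
Lemma ev3X a b c : ev3 a b c 'X = c.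
Proof. by rewrite /ev3 /= map_polyX /horner_eval hornerX. Qed.
Lemma ev3Y a b c : ev3 a b c ('X%:P) = b.
Proof. by rewrite /ev3 /= map_polyC /= /horner_eval hornerX !hornerC. Qed.
Lemma ev3Z a b c : ev3 a b c (('X%:P)%:P) = a.
Proof. by rewrite /ev3 /= map_polyC /= /horner_eval !hornerC hornerX. Qed.

Lemma ev3_v2 a b c : ev3 a b c v2 = b - mu * c.
Proof. by rewrite /v2 rmorphB rmorphM ev3Y ev3X ev3_cst. Qed.
Lemma ev3_v1 a b c : ev3 a b c v1 = al^-1 * (a - be * (b - mu * c) - ga * c).
Proof.
rewrite /v1 rmorphM ev3_cst; congr (_ * _); rewrite [LHS]rmorphB.
congr (_ - _); last by rewrite rmorphM ev3_cst ev3X.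
by rewrite rmorphB ev3Z; congr (_ - _); rewrite rmorphM ev3_cst ev3_v2.
Qed.

Lemma ev3_tri a b c p : ev3 a b c (tri p) = toC (peval p (pt a b c)).
Proof.
elim: p => [k|i|p IHp q IHq|p IHp q IHq].
- exact: ev3_cst.
- case: i => [|[|i]]; rewrite [tri _]/= [peval _ _]/= ofCK.
  + by rewrite ev3_v1.
  + by rewrite ev3_v2.
  + by rewrite ev3X.
- by rewrite [peval _ _]/= toC_add -IHp -IHq -rmorphD.
- by rewrite [peval _ _]/= toC_mul -IHp -IHq -rmorphM.
Qed.

Lemma size_cst k : (size (cst k) <= 1)%N.
Proof. exact: size_polyC_leq1. Qed.

Lemma size_v2 : (size v2 <= 2)%N.
Proof.
rewrite /v2 (leq_trans (size_polyD _ _)) // geq_max size_polyN.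
rewrite (leq_trans (size_polyC_leq1 _)) //=.
by rewrite (leq_trans (size_polyMleq _ _)) // size_polyX addn2 /= ltnS size_cst.
Qed.

Lemma size_cstM k (f : {poly K}) n : (size f <= n)%N -> (size (cst k * f)%R <= n)%N.
Proof.
move=> fn; rewrite (leq_trans (size_polyMleq _ _)) //.
have := size_cst k; case: (size _) => [|[|//]] _ /=.
  by rewrite add0n (leq_trans (leq_pred _)).
by [].
Qed.

Lemma size_v1 : (size v1 <= 2)%N.
Proof.
apply: size_cstM; rewrite (leq_trans (size_polyD _ _)) // geq_max size_polyN.
rewrite (leq_trans (size_polyD _ _)) ?geq_max ?size_polyN /=.
  by apply: size_cstM; rewrite size_polyX.
by rewrite (leq_trans (size_polyC_leq1 _)) //=; apply: size_cstM; apply: size_v2.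
Qed.

Lemma size_tri p : (size (tri p) <= (pdeg p).+1)%N.
Proof.
elim: p => [k|i|p IHp q IHq|p IHp q IHq].
- exact: size_cst.
- case: i => [|[|i]] /=; [exact: size_v1|exact: size_v2|by rewrite size_polyX].
- rewrite /= (leq_trans (size_polyD _ _)) // geq_max.
  rewrite (leq_trans IHp) ?(leq_trans IHq) // ltnS; apply/ssrnat.leP; lia.
- rewrite /= (leq_trans (size_polyMleq _ _)) //.
  have := leq_add IHp IHq; rewrite addSn addnS; by case: (size _ + size _)%N.
Qed.

Lemma tri_pow p n : tri (PPow p n) = tri p ^+ n.
Proof.
elim: n => [|n IH]; first by rewrite [tri _]/= /cst toC_one !polyC1 expr0.
by rewrite exprS -IH.
Qed.

(** The added monomial has degree [D] in [c], above everything coming from [p], so the leading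
    coefficient is a constant. For [i = 1] it contains a power of [-mu], whence the condition
    [mu != 0]. *)
Lemma lead_perturb (i D : nat) (eta k : Cx) p :
  (pdeg p < D)%nat -> toC eta != 0 ->
  size (tri (PVar i)) = 2%N ->
  lead_coef (tri (perturb i D eta k p)) =
    (toC eta)%:P%:P * lead_coef (tri (PVar i)) ^+ D.
Proof.
move=> pD eta0 sv.
have D0 : (0 < D)%N by case: D pD.
have v0 : tri (PVar i) != 0 by rewrite -size_poly_gt0 sv.
have sX : size (tri (PVar i) ^+ D) = D.+1.
  by rewrite -[LHS]prednK ?size_exp ?sv ?mul1n // size_poly_gt0 expf_neq0.
have lt : (size (cst (toC k)) < size (tri (PVar i) ^+ D)%R)%N.
  by rewrite sX ltnS (leq_trans (size_cst _)).
have sz : size (tri (PVar i) ^+ D + cst (toC k)) = D.+1 by rewrite size_polyDl.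
have lc : lead_coef (tri (PVar i) ^+ D + cst (toC k)) = lead_coef (tri (PVar i)) ^+ D.
  by rewrite lead_coefDl ?lead_coef_exp.
have -> : tri (perturb i D eta k p) =
  tri p + cst (toC eta) * (tri (PVar i) ^+ D + cst (toC k)).
  by rewrite -tri_pow.
rewrite lead_coefDr; first by rewrite lead_coefM lc lead_coefC.
rewrite mul_polyC size_scale ?polyC_eq0 // sz.
by rewrite ltnS (leq_trans (size_tri _)).
Qed.

Lemma v2_size2 : size v2 = 2%N /\ lead_coef v2 = - (mu%:P%:P).
Proof.
have s : size (cst mu * 'X) = 2%N.
  by rewrite mul_polyC size_scale ?size_polyX // !polyC_eq0.
have l : (size ('X%:P : {poly K}) < size (- (cst mu * 'X)))%N.
  by rewrite size_polyN s ltnS size_polyC_leq1.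
split; rewrite /v2.
  by rewrite addrC size_polyDl // size_polyN.
by rewrite lead_coefDr // lead_coefN lead_coefM lead_coefX mulr1 lead_coefC.
Qed.

Section Pair.
Variables (p q : poly3) (D : nat) (eta k2 k3 : Cx).
Hypotheses (pD : (pdeg p < D)%nat) (qD : (pdeg q < D)%nat) (eta0 : toC eta != 0).
Let pp := perturb 2 D eta k3 p.
Let qq := perturb 1 D eta k2 q.
Let res := resultant (tri pp) (tri qq).

Lemma lead_pp a b : ev2 a b (lead_coef (tri pp)) != 0.
Proof.
rewrite lead_perturb ?size_polyX // /= lead_coefX expr1n mulr1.
by rewrite /horner_eval !hornerC.
Qed.

Lemma lead_qq a b : ev2 a b (lead_coef (tri qq)) != 0.
Proof.
have [s l] := v2_size2.
rewrite lead_perturb // [lead_coef _]l rmorphM rmorphXn rmorphN /=.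
by rewrite /horner_eval !hornerC mulf_neq0 // expf_neq0 // oppr_eq0.
Qed.

(** Neither leading coefficient vanishes at any [(a, b)], so the resultant commutes with evaluation
    there; over an algebraically closed field it vanishes exactly when a common root [c] exists. The
    projection of the curve to the [(a, b)]-plane is thus a plane algebraic set. *)
Lemma resP a b : reflect (exists c, common_zero pp qq (pt a b c)) (ev2 a b res == 0).
Proof.
have -> : ev2 a b res = resultant (map_poly (ev2 a b) (tri pp)) (map_poly (ev2 a b) (tri qq)).
  by apply: map_resultant; [apply: lead_pp|apply: lead_qq].
rewrite resultant_eq0.
set P := map_poly _ _; set Q := map_poly _ _.
have P0 : P != 0.
  rewrite -lead_coef_eq0 lead_coef_map_eq ?lead_pp //.
have g0 : gcdp P Q != 0 by rewrite gcdp_eq0 negb_and P0.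
have -> : (1 < size (gcdp P Q))%N = (size (gcdp P Q) != 1%N).
  by move: g0; rewrite -size_poly_gt0; case: (size _) => [|[|]].
have evp c r : (root (map_poly (ev2 a b) (tri r)) c) = (toC (peval r (pt a b c)) == 0).
  by rewrite -ev3_tri.
apply: (iffP (closed_rootP _)) => -[c].
  rewrite root_gcd !evp => /andP[/eqP h1 /eqP h2]; exists c.
  by split; apply: toC_inj.
by move=> [h1 h2]; exists c; rewrite root_gcd !evp -!toC_zero h1 h2 !eqxx.
Qed.


Lemma pt_coord (z : C3) :
  pt (toC (lin (ofC al) (ofC be) (ofC ga) z)) (toC (Defs.coord 1 z) + mu * toC (Defs.coord 2 z))
     (toC (Defs.coord 2 z)) = z.
Proof.
case: z => [[z1 z2] z3]; rewrite /lin !toC_add !toC_mul !ofCK /= /pt addrK.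
congr (_, _, _); rewrite ?toCK //.
have -> : al * toC z1 + (be * toC z2 + ga * toC z3) - be * toC z2 - ga * toC z3 = al * toC z1.
  by rewrite -[_ - _ - _]addrA -opprD addrK.
by rewrite mulKf // toCK.
Qed.

Lemma lin_pt a b c : toC (lin (ofC al) (ofC be) (ofC ga) (pt a b c)) = a.
Proof.
rewrite /lin !toC_add !toC_mul !ofCK /= mulVKf //.
by rewrite -[X in X + _]addrA -opprD subrK.
Qed.

Lemma m_pt a b c : toC (Defs.coord 1 (pt a b c)) + mu * toC (Defs.coord 2 (pt a b c)) = b.
Proof. by rewrite /= !ofCK subrK. Qed.

End Pair.
End Param.

Lemma poly_bounded (g : {poly C}) (M : C) : 0 <= M ->
  exists2 B, 0 <= B & forall a, `|a| <= M -> `|g.[a]| <= B.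
Proof.
move=> M0; elim/poly_ind: g => [|g c [B B0 IH]].
  by exists 0 => // a _; rewrite horner0 normr0.
exists (B * M + `|c|) => [|a aM]; first by rewrite addr_ge0 ?mulr_ge0.
rewrite hornerMXaddC (le_trans (ler_normD _ _)) // lerD2r normrM.
by rewrite ler_pM ?IH.
Qed.

Lemma poly_continuous (g : {poly C}) (a1 e : C) : 0 < e ->
  exists2 d, 0 < d & forall a, `|a - a1| < d -> `|g.[a] - g.[a1]| < e.
Proof.
move=> e0.
have /factor_theorem[k kE] : root (g - g.[a1]%:P) a1 by rewrite rootE !hornerE subrr.
have [B B0 kB] := poly_bounded k _ (addr_ge0 (normr_ge0 a1) ler01).
have B1 : 0 < B + 1 by rewrite ltr_wpDl.
exists (Num.min 1 (e / (B + 1))) => [|a].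
  have : (1 : C) >=< e / (B + 1) by rewrite real_comparable ?ger0_real ?divr_ge0 // ltW.
  by move=> cmp; rewrite comparable_lt_min // ltr01 divr_gt0.
have cmp : (1 : C) >=< e / (B + 1) by rewrite real_comparable ?ger0_real ?divr_ge0 // ltW.
rewrite comparable_lt_min // => /andP[a1lt alt].
have -> : g.[a] - g.[a1] = k.[a] * (a - a1).
  by have := congr1 (horner^~ a) kE; rewrite !hornerE.
have ka : `|k.[a]| <= B.
  apply: kB; rewrite -[a](subrK a1) addrC (le_trans (ler_normD _ _)) // lerD2l ltW //.
rewrite normrM (le_lt_trans (ler_wpM2r (normr_ge0 _) ka)) //.
rewrite (@le_lt_trans _ _ ((B + 1) * `|a - a1|)) ?ler_wpM2r ?lerDl //.
by rewrite mulrC -ltr_pdivlMr.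
Qed.

Lemma prod_dist_le (r : seq C) (b1 b2 e : C) :
  `|b2 - b1| <= e -> all (fun z => e <= `|b1 - z|) r ->
  `|\prod_(z <- r) (b2 - z)| <= 2 ^+ size r * `|\prod_(z <- r) (b1 - z)|.
Proof.
move=> b12; elim: r => [_|z r IH /= /andP[hz hr]]; first by rewrite !big_nil mul1r.
rewrite !big_cons !normrM exprS mulrACA ler_pM ?IH //.
rewrite -(subrKA b1) (le_trans (ler_normD _ _)) // mulr2n mulrDl !mul1r.
by rewrite lerD2r (le_trans b12).
Qed.

Lemma nonroot_near (g : {poly C}) (b1 e : C) : g != 0 -> 0 < e ->
  exists2 b2, `|b2 - b1| <= e & g.[b2] != 0.
Proof.
move=> g0 e0.
pose s := [seq b1 + e / i.+1%:R | i <- iota 0 (size g)].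
have us : uniq s.
  rewrite map_inj_uniq ?iota_uniq // => i j /addrI /(mulfI (lt0r_neq0 e0)) /invr_inj /eqP.
  by rewrite eqr_nat eqSS => /eqP.
case: (boolP (all (root g) s)) => [ars|].
  by have := max_poly_roots g0 ars us; rewrite size_map size_iota ltnn.
rewrite -has_predC => /hasP[b2 /mapP[i _ ->] /= nr].
exists (b1 + e / i.+1%:R) => //.
have ge : 0 <= e / i.+1%:R by rewrite divr_ge0 ?ler0n // ltW.
rewrite addrAC subrr add0r (ger0_norm ge).
by rewrite ler_pdivrMr ?ltr0Sn // ler_peMr ?ler1n // ltW.
Qed.

(** An elementary substitute for Rouché's theorem. Pick [b2] within [e] of [b1] with [H(a1, b2)]
    nonzero. If [H(a, .)] had no root within [e] of [b1], factoring it would give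
    [|H(a, b2)| <= 2^N |H(a, b1)|]; as [a] tends to [a1] the right side tends to 0 and the left side
    does not. *)
Lemma root_persistence (H : {poly {poly C}}) (a1 b1 b0 e : C) :
  ev2 a1 b1 H = 0 -> ev2 a1 b0 H != 0 -> 0 < e ->
  exists2 d, 0 < d & forall a, `|a - a1| < d -> exists2 b, `|b - b1| < e & ev2 a b H = 0.
Proof.
move=> H1 H0 e0.
pose Ha a := map_poly (horner_eval a) H.
have HaE a b : (Ha a).[b] = ev2 a b H.
  by have := horner_map (horner_eval a) H b%:P; rewrite /= /horner_eval hornerC.
have Ha1 : Ha a1 != 0 by apply: contraNneq H0 => h; rewrite -HaE h horner0.
have [b2 b21 b2n] := nonroot_near _ b1 _ Ha1 e0.
pose c := `|(Ha a1).[b2]|.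
have c0 : 0 < c by rewrite normr_gt0.
pose N := size H.
have c10 : 0 < c / 2 / 2 ^+ N by rewrite !divr_gt0 // exprn_gt0.
have [d1 d10 h1] := poly_continuous H.[b1%:P] a1 _ c10.
have c20 : 0 < c / 2 by rewrite divr_gt0.
have [d2 d20 h2] := poly_continuous H.[b2%:P] a1 _ c20.
have cmp : d1 >=< d2 by rewrite real_comparable ?gtr0_real.
exists (Num.min d1 d2) => [|a]; first by rewrite comparable_lt_min // d10.
rewrite comparable_lt_min // => /andP[/h1 {}h1 /h2 {}h2].
have {h1} h1 : `|(Ha a).[b1]| < c / 2 / 2 ^+ N.
  by move: h1; rewrite HaE /= /horner_eval -[H.[b1%:P].[a1]]/(ev2 a1 b1 H) H1 subr0.
have {h2} h2 : c / 2 < `|(Ha a).[b2]|.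
  have : c <= `|(Ha a).[b2]| + `|(Ha a).[b2] - (Ha a1).[b2]|.
    by rewrite /c -[X in `|X| <= _](subKr (Ha a).[b2]) (le_trans (ler_normB _ _)).
  have -> : c / 2 = c - c / 2 by rewrite {2}[c](splitr c) addrK.
  by rewrite ltrBlDr => hh; rewrite (le_lt_trans hh) // ltrD2l !HaE.
have [r rE] := closed_field_poly_normal (Ha a).
have Ha0 : Ha a != 0.
  by apply: contraTneq h2 => ->; rewrite horner0 normr0 (lt_gtF c20).
case: (boolP (all (fun z => e <= `|b1 - z|) r)) => [hr|].
  have rN : (size r <= N)%N.
    have : (size (Ha a) <= N)%N by apply: size_poly.
    by rewrite rE size_scale ?lead_coef_eq0 // size_prod_XsubC => /ltnW.
  have hE b : (Ha a).[b] = lead_coef (Ha a) * \prod_(z <- r) (b - z).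
    rewrite {1}rE hornerZ horner_prod; congr (_ * _).
    by apply: eq_bigr => z _; rewrite !hornerE.
  have le : `|(Ha a).[b2]| <= 2 ^+ N * `|(Ha a).[b1]|.
    rewrite !hE !normrM mulrCA ler_wpM2l // (le_trans (prod_dist_le r b1 b2 e b21 hr)) //.
    by rewrite ler_wpM2r // ler_weXn2l // ler1n.
  have lt : 2 ^+ N * `|(Ha a).[b1]| < c / 2 by rewrite mulrC -ltr_pdivlMr // exprn_gt0.
  by move: (lt_trans (lt_le_trans h2 le) lt); rewrite ltxx.
rewrite -has_predC => /hasP[b br hb]; exists b.
  by move: hb; rewrite /= distrC real_ltNge ?normr_real // gtr0_real.
by rewrite -HaE rE hornerZ horner_prod (big_rem b) //= hornerXsubC subrr mul0r mulr0.
Qed.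

Lemma toC_neq0 (a : Cx) : a <> Czero -> toC a != 0.
Proof. by move=> a0; apply/eqP; rewrite -toC_zero => /toC_inj. Qed.

Lemma RltC (a b : R) : Rlt a b <-> Complex a 0 < Complex b 0.
Proof.
rewrite ltcE /= eqxx /=; split=> [h|h]; first exact/RltP.
exact/RltP.
Qed.

(** A value [b0] missed by [m] on the fibre through [z1] certifies that the resultant is not
    identically zero in [b] there, as [root_persistence] requires. *)
Lemma fiber_persistence (p q : poly3) (D : nat) (eta k2 k3 al be ga mu b0 : Cx) (z1 : C3) :
  Peano.lt (pdeg p) D -> Peano.lt (pdeg q) D ->
  eta <> Czero -> al <> Czero -> mu <> Czero ->
  let Z := common_zero (perturb 2 D eta k3 p) (perturb 1 D eta k2 q) in
  let m z := Cadd (Defs.coord 1 z) (Cmul mu (Defs.coord 2 z)) in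
  Z z1 -> (forall z, Z z -> lin al be ga z = lin al be ga z1 -> m z <> b0) ->
  forall e, Rlt 0 e -> exists d, Rlt 0 d /\
    forall a, Rlt (Cmod (Csub a (lin al be ga z1))) d ->
      exists z, Z z /\ lin al be ga z = a /\ Rlt (Cmod (Csub (m z) (m z1))) e.
Proof.
move=> /ssrnat.ltP pD /ssrnat.ltP qD /toC_neq0 eta0 /toC_neq0 al0 /toC_neq0 mu0 Z m Zz nb e /RltC e0.
have rP := resP (toC al) (toC be) (toC ga) (toC mu) mu0 p q D eta k2 k3 pD qD eta0.
have ptc := pt_coord (toC al) (toC be) (toC ga) (toC mu) al0.
have lpt := lin_pt (toC al) (toC be) (toC ga) (toC mu) al0.
have mpt := m_pt (toC al) (toC be) (toC ga) (toC mu).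
rewrite !toCK in ptc lpt.
have mE z : toC (m z) = toC (Defs.coord 1 z) + toC mu * toC (Defs.coord 2 z).
  by rewrite /m toC_add toC_mul.
have h1 : ev2 (toC (lin al be ga z1)) (toC (m z1)) (resultant
   (tri (toC al) (toC be) (toC ga) (toC mu) (perturb 2 D eta k3 p))
   (tri (toC al) (toC be) (toC ga) (toC mu) (perturb 1 D eta k2 q))) = 0.
  by apply/eqP/rP; exists (toC (Defs.coord 2 z1)); rewrite mE ptc.
have h0 : ev2 (toC (lin al be ga z1)) (toC b0) (resultant
   (tri (toC al) (toC be) (toC ga) (toC mu) (perturb 2 D eta k3 p))
   (tri (toC al) (toC be) (toC ga) (toC mu) (perturb 1 D eta k2 q))) != 0.
  apply/negP => /rP[c /nb]; apply.
    by apply: toC_inj; rewrite lpt.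
  by apply: toC_inj; rewrite mE mpt.
have [d d0 hd] := root_persistence _ _ _ _ _ h1 h0 e0.
have [d' /RltC d'0 dE] : exists2 d', Rlt 0 d' & d = Complex d' 0.
  case: d d0 {hd} => d1 d2; rewrite ltcE /= => /andP[/eqP h1' h2'].
  by exists d1; [exact/RltP | congr Complex].
subst d; exists d'; split; first exact/RltC.
move=> a /RltC ha.
have [|b hb /eqP/rP[c hc]] := hd (toC a).
  by rewrite -toC_sub toC_norm.
exists (pt (toC al) (toC be) (toC ga) (toC mu) (toC a) b c); split; [exact: hc|split].
  by apply: toC_inj; rewrite lpt.
by apply/RltC; rewrite -toC_norm toC_sub [toC (m _)]mE mpt.
Qed.

(** Over [a] the resultant is a nonzero polynomial in [b], and for each of its roots [b] the first
    equation is a nonzero polynomial in [c]. *)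
Lemma fiber_finite (p q : poly3) (D : nat) (eta k2 k3 al be ga mu b0 a : Cx) :
  Peano.lt (pdeg p) D -> Peano.lt (pdeg q) D ->
  eta <> Czero -> al <> Czero -> mu <> Czero ->
  let Z := common_zero (perturb 2 D eta k3 p) (perturb 1 D eta k2 q) in
  let m z := Cadd (Defs.coord 1 z) (Cmul mu (Defs.coord 2 z)) in
  (forall z, Z z -> lin al be ga z = a -> m z <> b0) ->
  exists L : list C3, forall z, Z z -> lin al be ga z = a -> List.In z L.
Proof.
move=> /ssrnat.ltP pD /ssrnat.ltP qD /toC_neq0 eta0 /toC_neq0 al0 /toC_neq0 mu0 Z m nb.
have rP := resP (toC al) (toC be) (toC ga) (toC mu) mu0 p q D eta k2 k3 pD qD eta0.
have ptc := pt_coord (toC al) (toC be) (toC ga) (toC mu) al0.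
have lpt := lin_pt (toC al) (toC be) (toC ga) (toC mu) al0.
have mpt := m_pt (toC al) (toC be) (toC ga) (toC mu).
have ldp := lead_pp (toC al) (toC be) (toC ga) (toC mu) p D eta k3 pD eta0.
have evE := ev3_tri (toC al) (toC be) (toC ga) (toC mu).
rewrite !toCK in ptc lpt.
have mE z : toC (m z) = toC (Defs.coord 1 z) + toC mu * toC (Defs.coord 2 z).
  by rewrite /m toC_add toC_mul.
move: rP evE ldp; set res := resultant _ _; set tp := tri _ _ _ _ _ => rP evE ldp.
pose Ha := map_poly (horner_eval (toC a)) res.
have HaE b : Ha.[b] = ev2 (toC a) b res.
  by have := horner_map (horner_eval (toC a)) res b%:P; rewrite /= /horner_eval hornerC.
have h0 : ev2 (toC a) (toC b0) res != 0.
  apply/negP => /rP[c /nb]; apply.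
    by apply: toC_inj; rewrite lpt.
  by apply: toC_inj; rewrite mE mpt.
have Ha0 : Ha != 0 by apply: contraNneq h0 => h; rewrite -HaE h horner0.
have [r rE] := closed_field_poly_normal Ha.
pose P b := map_poly (ev2 (toC a) b) tp.
have P0 b : P b != 0.
  rewrite -lead_coef_eq0 lead_coef_map_eq ?ldp //.
pose roots b := sval (closed_field_poly_normal (P b)).
have memr (F : closedFieldType) (g : {poly F}) (s : seq F) x : g != 0 ->
    g = lead_coef g *: \prod_(z <- s) ('X - z%:P) -> root g x -> x \in s.
  by move=> g0 ->; rewrite rootZ ?lead_coef_eq0 // root_prod_XsubC.
exists (flatten [seq [seq pt (toC al) (toC be) (toC ga) (toC mu) (toC a) b c | c <- roots b] | b <- r]).
move=> z Zz la.
have inL (T : eqType) (x : T) s : x \in s -> List.In x s.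
  by elim: s => //= y s IH; rewrite inE => /orP[/eqP ->|/IH]; [left|right].
have inF (T : Type) (x : T) (s : seq T) ss : List.In s ss -> List.In x s -> List.In x (flatten ss).
  elim: ss => //= s1 ss IH [->|h] hx; apply: List.in_or_app; first by left.
  by right; apply: IH.
pose b := toC (m z); pose c := toC (Defs.coord 2 z).
have zE : pt (toC al) (toC be) (toC ga) (toC mu) (toC a) b c = z by rewrite -la /b mE ptc.
have br : b \in r.
  by apply: (memr _ Ha) => //; rewrite rootE HaE; apply/rP; exists c; rewrite zE.
have cr : c \in roots b.
  apply: (memr _ (P b)) => //; first by rewrite /roots; case: closed_field_poly_normal.
  rewrite /root -[_.[c]]/(ev3 (toC a) b c tp) evE zE; case: Zz => -> _; exact/eqP.
apply: (inF _ _ [seq pt (toC al) (toC be) (toC ga) (toC mu) (toC a) b c | c <- roots b]).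
  by apply: (List.in_map (fun b => [seq pt (toC al) (toC be) (toC ga) (toC mu) (toC a) b c | c <- roots b])); apply: inL.
by rewrite -zE; apply: (List.in_map (fun c => pt (toC al) (toC be) (toC ga) (toC mu) (toC a) b c)); apply: inL.
Qed.
End Elimination.

(** * Moduli, convergence and bounded sequences *)

Lemma Cmod_ge0 a : 0 <= Cmod a.
Proof. exact (Cmod_ge_0 a). Qed.
Lemma Cmod_Cmul a b : Cmod (Cmul a b) = Cmod a * Cmod b.
Proof. exact (Cmod_mult a b). Qed.
Lemma Cmod_Cadd a b : Cmod (Cadd a b) <= Cmod a + Cmod b.
Proof. exact (Cmod_triangle a b). Qed.
Lemma Cmod_Csub_sym a b : Cmod (Csub a b) = Cmod (Csub b a).
Proof. unfold Cmod, Csub; simpl; f_equal; ring. Qed.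
Lemma Cmod_eq0 a : Cmod a = 0 -> a = Czero.
Proof. exact (Cmod_eq_0 a). Qed.
Lemma Cmod_Czero : Cmod Czero = 0.
Proof. exact Cmod_0. Qed.
Lemma Cmod_Cone : Cmod Cone = 1.
Proof. exact Cmod_1. Qed.
Lemma Cmod_pos a : a <> Czero -> 0 < Cmod a.
Proof. exact (proj1 (Cmod_gt_0 a)). Qed.
Lemma Cmod_sqr a : Cmod a * Cmod a = fst a * fst a + snd a * snd a.
Proof.
  unfold Cmod. rewrite sqrt_sqrt; nra.
Qed.
Lemma abs_fst_le a : Rabs (fst a) <= Cmod a.
Proof.
  apply Rabs_le; pose proof (Cmod_sqr a); pose proof (Cmod_ge0 a); split; nra.
Qed.
Lemma abs_snd_le a : Rabs (snd a) <= Cmod a.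
Proof.
  apply Rabs_le; pose proof (Cmod_sqr a); pose proof (Cmod_ge0 a); split; nra.
Qed.
Lemma Cmod_le_sum a : Cmod a <= Rabs (fst a) + Rabs (snd a).
Proof.
  pose proof (Cmod_sqr a); pose proof (Cmod_ge0 a).
  pose proof (Rabs_pos (fst a)); pose proof (Rabs_pos (snd a)).
  assert (Rabs (fst a) * Rabs (fst a) = fst a * fst a) by (rewrite <- Rabs_mult; apply Rabs_pos_eq; nra).
  assert (Rabs (snd a) * Rabs (snd a) = snd a * snd a) by (rewrite <- Rabs_mult; apply Rabs_pos_eq; nra).
  nra.
Qed.
Lemma Cmod_tri a b : Cmod a <= Cmod b + Cmod (Csub a b).
Proof.
  replace a with (Cadd b (Csub a b)) at 1.
  - apply Cmod_Cadd.
  - destruct a, b; unfold Cadd, Csub; simpl; f_equal; ring.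
Qed.
Lemma Cmul_Czero a b : Cmul a b = Czero -> a = Czero \/ b = Czero.
Proof.
  intros H. assert (E : Cmod a * Cmod b = 0) by (rewrite <- Cmod_Cmul, H; apply Cmod_Czero).
  apply Rmult_integral in E; destruct E as [E|E]; apply Cmod_eq0 in E; auto.
Qed.
Lemma Csub_eq a b : Csub a b = Czero -> a = b.
Proof.
  destruct a, b; unfold Csub, Czero; simpl; intros H; injection H; intros; f_equal; lra.
Qed.

Definition cvC (u : nat -> Cx) (l : Cx) : Prop :=
  is_lim_seq (fun n => fst (u n)) (fst l) /\ is_lim_seq (fun n => snd (u n)) (snd l).

Definition cv3 (u : nat -> C3) (l : C3) : Prop :=
  forall i, cvC (fun n => coord i (u n)) (coord i l).

Lemma cvC_const a : cvC (fun _ => a) a.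
Proof. split; apply is_lim_seq_const. Qed.

Lemma cvC_add u v a b : cvC u a -> cvC v b -> cvC (fun n => Cadd (u n) (v n)) (Cadd a b).
Proof. intros [H1 H2] [H3 H4]; split; simpl; apply is_lim_seq_plus'; assumption. Qed.
Lemma cvC_sub u v a b : cvC u a -> cvC v b -> cvC (fun n => Csub (u n) (v n)) (Csub a b).
Proof. intros [H1 H2] [H3 H4]; split; simpl; apply is_lim_seq_minus'; assumption. Qed.
Lemma cvC_mul u v a b : cvC u a -> cvC v b -> cvC (fun n => Cmul (u n) (v n)) (Cmul a b).
Proof.
  intros [H1 H2] [H3 H4]; split; simpl.
  - apply is_lim_seq_minus'; apply is_lim_seq_mult'; assumption.
  - apply is_lim_seq_plus'; apply is_lim_seq_mult'; assumption.
Qed.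

Lemma cvC_peval p u l : cv3 u l -> cvC (fun n => peval p (u n)) (peval p l).
Proof.
  intros H; induction p; simpl.
  - apply cvC_const.
  - apply H.
  - apply cvC_add; assumption.
  - apply cvC_mul; assumption.
Qed.

Lemma cvC_Cmod u l : cvC u l -> is_lim_seq (fun n => Cmod (u n)) (Cmod l).
Proof.
  intros [H1 H2]; unfold Cmod.
  apply (is_lim_seq_continuous sqrt).
  - apply continuity_pt_sqrt. nra.
  - simpl. apply is_lim_seq_plus'; apply is_lim_seq_mult'; try assumption;
    apply is_lim_seq_mult'; try assumption; apply is_lim_seq_const.
Qed.

Lemma cvC_unique u a b : cvC u a -> cvC u b -> a = b.
Proof.
  intros [H1 H2] [H3 H4].
  apply is_lim_seq_unique in H1; apply is_lim_seq_unique in H2.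
  apply is_lim_seq_unique in H3; apply is_lim_seq_unique in H4.
  rewrite H1 in H3; rewrite H2 in H4; injection H3; injection H4; intros.
  destruct a, b; simpl in *; congruence.
Qed.

Lemma cvC_of_Cmod u l : is_lim_seq (fun n => Cmod (Csub (u n) l)) 0 -> cvC u l.
Proof.
  intros H; split; apply is_lim_seq_spec; apply is_lim_seq_spec in H;
  intros eps; destruct (H eps) as [N HN]; exists N; intros n Hn; specialize (HN n Hn);
  rewrite Rminus_0_r, Rabs_pos_eq in HN by apply Cmod_ge0.
  - eapply Rle_lt_trans; [apply (abs_fst_le (Csub (u n) l))|exact HN].
  - eapply Rle_lt_trans; [apply (abs_snd_le (Csub (u n) l))|exact HN].
Qed.

(** Subsequences are reindexings with [n <= s n], not necessarily increasing: this is enough to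
    preserve limits and composes easily. *)
Lemma is_lim_seq_comp_ge (u : nat -> R) (l : R) (s : nat -> nat) :
  (forall n, (n <= s n)%nat) -> is_lim_seq u l -> is_lim_seq (fun n => u (s n)) l.
Proof.
  intros Hs H. apply is_lim_seq_spec; apply is_lim_seq_spec in H.
  intros eps; destruct (H eps) as [N HN]; exists N; intros n Hn; apply HN.
  specialize (Hs n); lia.
Qed.

Lemma cvC_comp_ge u l s : (forall n, (n <= s n)%nat) -> cvC u l -> cvC (fun n => u (s n)) l.
Proof.
  intros Hs [H1 H2]; split.
  - apply (is_lim_seq_comp_ge (fun n => fst (u n))); assumption.
  - apply (is_lim_seq_comp_ge (fun n => snd (u n))); assumption.
Qed.

Lemma is_lim_seq_inv_S : is_lim_seq (fun n => / (INR n + 1)) 0.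
Proof.
  apply is_lim_seq_ext with (fun n => / INR (S n)).
  - intros n; rewrite S_INR; reflexivity.
  - apply (is_lim_seq_incr_1 (fun n => / INR n)).
    apply (is_lim_seq_inv INR p_infty); [apply is_lim_seq_INR|discriminate].
Qed.

Lemma inv_S_pos n : 0 < / (INR n + 1).
Proof. apply Rinv_0_lt_compat. pose proof (pos_INR n); lra. Qed.

Lemma lim_squeeze0 (u v : nat -> R) :
  (forall n, 0 <= u n <= v n) -> is_lim_seq v 0 -> is_lim_seq u 0.
Proof.
  intros H Hv. apply is_lim_seq_le_le with (fun _ => 0) v; auto. apply is_lim_seq_const.
Qed.

Lemma bw_real (u : nat -> R) (M : R) : (forall n, Rabs (u n) <= M) ->
  exists s : nat -> nat, (forall n, (n <= s n)%nat) /\ exists l : R, is_lim_seq (fun n => u (s n)) l.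
Proof.
  intros HM.
  destruct (Bolzano_Weierstrass u (fun x => -M <= x <= M)) as [l Hl].
  - apply compact_P3.
  - intros n; specialize (HM n); apply Rabs_le_between in HM; lra.
  - assert (E : forall n : nat, exists k, (n <= k)%nat /\ Rabs (u k - l) < / (INR n + 1)).
    { intros n. destruct (Hl (disc l (mkposreal _ (inv_S_pos n))) n) as [k [Hk1 Hk2]].
      - exists (mkposreal _ (inv_S_pos n)); intros x Hx; exact Hx.
      - exists k; split; [exact Hk1|exact Hk2]. }
    set (s := fun n => proj1_sig (constructive_indefinite_description _ (E n))).
    assert (Hs : forall n, (n <= s n)%nat /\ Rabs (u (s n) - l) < / (INR n + 1))
      by (intros n; unfold s; destruct constructive_indefinite_description; assumption).
    exists s; split; [intros n; apply Hs|exists l].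
    apply is_lim_seq_ext with (fun n => (u (s n) - l) + l); [intros; ring|].
    replace (Finite l) with (Finite (0 + l)) by (f_equal; ring).
    apply is_lim_seq_plus'; [|apply is_lim_seq_const].
    apply is_lim_seq_abs_0. apply lim_squeeze0 with (2 := is_lim_seq_inv_S).
    intros n; split; [apply Rabs_pos|left; apply Hs].
Qed.

Lemma bw_Cx (u : nat -> Cx) (M : R) : (forall n, Cmod (u n) <= M) ->
  exists s : nat -> nat, (forall n, (n <= s n)%nat) /\ exists l, cvC (fun n => u (s n)) l.
Proof.
  intros HM.
  destruct (bw_real (fun n => fst (u n)) M) as [s [Hs [l Hl]]].
  { intros n; eapply Rle_trans; [apply abs_fst_le|apply HM]. }
  destruct (bw_real (fun n => snd (u (s n))) M) as [s' [Hs' [l' Hl']]].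
  { intros n; eapply Rle_trans; [apply abs_snd_le|apply HM]. }
  exists (fun n => s (s' n)); split.
  - intros n; specialize (Hs' n); specialize (Hs (s' n)); lia.
  - exists (l, l'); split; simpl; [|exact Hl'].
    apply (is_lim_seq_comp_ge (fun n => fst (u (s n)))); assumption.
Qed.

Lemma bw_C3 (u : nat -> C3) (M : R) : (forall n i, Cmod (coord i (u n)) <= M) ->
  exists s : nat -> nat, (forall n, (n <= s n)%nat) /\ exists l, cv3 (fun n => u (s n)) l.
Proof.
  intros HM.
  destruct (bw_Cx (fun n => coord 0 (u n)) M) as [s0 [H0 [l0 L0]]]; [intros; apply HM|].
  destruct (bw_Cx (fun n => coord 1 (u (s0 n))) M) as [s1 [H1 [l1 L1]]]; [intros; apply HM|].
  destruct (bw_Cx (fun n => coord 2 (u (s0 (s1 n)))) M) as [s2 [H2 [l2 L2]]]; [intros; apply HM|].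
  exists (fun n => s0 (s1 (s2 n))); split.
  - intros n; specialize (H2 n); specialize (H1 (s2 n)); specialize (H0 (s1 (s2 n))); lia.
  - exists (l0, l1, l2). intros [|[|i]]; simpl.
    + apply (cvC_comp_ge (fun n => coord 0 (u (s0 n))) l0 (fun n => s1 (s2 n))); [|exact L0].
      intros n; specialize (H2 n); specialize (H1 (s2 n)); lia.
    + apply (cvC_comp_ge (fun n => coord 1 (u (s0 (s1 n)))) l1 s2); assumption.
    + exact L2.
Qed.

(** * Properness and local continuation of perturbed curves *)

Definition size3 (z : C3) : R := 1 + Cmod (coord 0 z) + Cmod (coord 1 z) + Cmod (coord 2 z).

Lemma size3_ge1 z : 1 <= size3 z.
Proof.
  unfold size3. pose proof (Cmod_ge0 (coord 0 z)); pose proof (Cmod_ge0 (coord 1 z));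
  pose proof (Cmod_ge0 (coord 2 z)); lra.
Qed.

Lemma Cmod_coord_le i z : Cmod (coord i z) <= size3 z.
Proof.
  unfold size3. pose proof (Cmod_ge0 (coord 0 z)); pose proof (Cmod_ge0 (coord 1 z));
  pose proof (Cmod_ge0 (coord 2 z)); destruct i as [|[|i]]; simpl in *; lra.
Qed.

Lemma peval_growth p : exists K, 0 <= K /\ forall z, Cmod (peval p z) <= K * size3 z ^ pdeg p.
Proof.
  induction p as [c|i|p [K [K0 H]] q [L [L0 G]]|p [K [K0 H]] q [L [L0 G]]]; simpl.
  - exists (Cmod c); split; [apply Cmod_ge0|intros; lra].
  - exists 1; split; [lra|intros z; rewrite Rmult_1_r, Rmult_1_l; apply Cmod_coord_le].
  - exists (K + L); split; [lra|intros z].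
    eapply Rle_trans; [apply Cmod_Cadd|]. specialize (H z); specialize (G z).
    pose proof (size3_ge1 z) as S1.
    assert (size3 z ^ pdeg p <= size3 z ^ Nat.max (pdeg p) (pdeg q)) by (apply Rle_pow; [lra|lia]).
    assert (size3 z ^ pdeg q <= size3 z ^ Nat.max (pdeg p) (pdeg q)) by (apply Rle_pow; [lra|lia]).
    nra.
  - exists (K * L); split; [nra|intros z].
    rewrite Cmod_Cmul, pow_add. specialize (H z); specialize (G z).
    replace (K * L * (size3 z ^ pdeg p * size3 z ^ pdeg q))
      with ((K * size3 z ^ pdeg p) * (L * size3 z ^ pdeg q)) by ring.
    apply Rmult_le_compat; auto using Cmod_ge0.
Qed.

Lemma peval_pow p n z : Cmod (peval (PPow p n) z) = Cmod (peval p z) ^ n.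
Proof.
  induction n; simpl; [apply Cmod_Cone|rewrite Cmod_Cmul, IHn; reflexivity].
Qed.

(** At a zero the term [eta z_i^D] is balanced by [p] and a constant, and where [z_i] dominates [z]
    these grow at most like [|z_i|^(D-1)]. *)
Lemma perturb_zero_bound p D eta k K (i : nat) : (pdeg p < D)%nat -> eta <> Czero -> 1 <= K ->
  exists M, forall z, peval (perturb i D eta k p) z = Czero ->
    1 <= Cmod (coord i z) -> size3 z <= K * Cmod (coord i z) -> Cmod (coord i z) <= M.
Proof.
  intros HD Heta HK. destruct (peval_growth p) as [G [G0 HG]].
  pose proof (Cmod_pos _ Heta) as E0.
  set (B := G * K ^ pdeg p + Cmod eta * Cmod k).
  exists (B / Cmod eta); intros z Hz H1 HS.
  set (W := Cmod (coord i z)) in *.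
  destruct D as [|D]; [lia|].
  assert (E : Cmod eta * W ^ S D <= Cmod (peval p z) + Cmod eta * Cmod k).
  { assert (E1 : Cmod eta * Cmod (peval (PPow (PVar i) (S D)) z) <= Cmod (peval p z) + Cmod eta * Cmod k).
    { unfold perturb in Hz; cbn [peval] in Hz. revert Hz.
      generalize (peval (PPow (PVar i) (S D)) z) (peval p z); intros w v Hz.
      rewrite <- !Cmod_Cmul.
      replace (Cmul eta w) with (Csub (Csub Czero v) (Cmul eta k)).
      - eapply Rle_trans; [apply (Cmod_tri _ (Csub Czero v))|].
        replace (Csub (Csub (Csub Czero v) (Cmul eta k)) (Csub Czero v)) with (Csub Czero (Cmul eta k))
          by (destruct v; unfold Csub; simpl; f_equal; ring).
        apply Req_le; f_equal; unfold Cmod, Csub, Czero; simpl; f_equal; ring.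
      - destruct v, w, eta, k; unfold Csub, Cadd, Cmul, Czero in *; simpl in *.
        injection Hz; intros; f_equal; lra. }
    rewrite peval_pow in E1. exact E1. }
  specialize (HG z).
  assert (E2 : size3 z ^ pdeg p <= K ^ pdeg p * W ^ D).
  { eapply Rle_trans; [apply pow_incr; split; [|exact HS]|].
    - pose proof (size3_ge1 z); lra.
    - rewrite Rpow_mult_distr. apply Rmult_le_compat_l; [apply pow_le; lra|].
      apply Rle_pow; [lra|lia]. }
  assert (W1 : 1 <= W ^ D) by (apply pow_R1_Rle; lra).
  assert (E3 : Cmod eta * W ^ S D <= B * W ^ D).
  { unfold B. pose proof (Cmod_ge0 k).
    assert (G * size3 z ^ pdeg p <= G * (K ^ pdeg p * W ^ D)) by (apply Rmult_le_compat_l; assumption).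
    assert (Cmod eta * Cmod k <= Cmod eta * Cmod k * W ^ D).
    { rewrite <- (Rmult_1_r (Cmod eta * Cmod k)) at 1.
      apply Rmult_le_compat_l; [apply Rmult_le_pos; lra|exact W1]. }
    lra. }
  simpl in E3. apply Rmult_le_reg_r with (Cmod eta); [assumption|].
  unfold Rdiv. rewrite Rmult_assoc, Rinv_l, Rmult_1_r by lra.
  apply Rmult_le_reg_r with (W ^ D); lra.
Qed.

Lemma inv_S_le1 n : / (INR n + 1) <= 1.
Proof.
  pose proof (pos_INR n). apply Rmult_le_reg_l with (INR n + 1); [lra|].
  rewrite Rinv_r; lra.
Qed.

Section Good.
Variables (p q : poly3) (D : nat) (eta k2 k3 : Cx).
Hypotheses (Hp : (pdeg p < D)%nat) (Hq : (pdeg q < D)%nat) (Heta : eta <> Czero).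
Let Z := common_zero (perturb 2 D eta k3 p) (perturb 1 D eta k2 q).

(** As [al] is nonzero, [z1] is controlled by [z2] and [z3]. Whichever of these two is larger then
    dominates [z], and the equation perturbed by its power bounds it; hence one equation is
    perturbed in each variable. *)
Lemma fiber_bounded al be ga A : al <> Czero -> 0 <= A ->
  exists M, forall z, Z z -> Cmod (lin al be ga z) <= A -> size3 z <= M.
Proof.
  intros Hal HA. pose proof (Cmod_pos _ Hal) as Al.
  set (c := (A + Cmod be + Cmod ga) / Cmod al).
  assert (c0 : 0 <= c).
  { apply Rmult_le_pos; [pose proof (Cmod_ge0 be); pose proof (Cmod_ge0 ga); lra|].
    left; apply Rinv_0_lt_compat; assumption. }
  set (K := 3 + c).
  destruct (perturb_zero_bound p D eta k3 K 2 Hp Heta) as [M3 H3]; [unfold K; lra|].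
  destruct (perturb_zero_bound q D eta k2 K 1 Hq Heta) as [M2 H2]; [unfold K; lra|].
  exists (K * Rmax 1 (Rmax M2 M3)). intros z [Zp Zq] Hl.
  set (W := Rmax 1 (Rmax (Cmod (coord 1 z)) (Cmod (coord 2 z)))).
  assert (W1 : 1 <= W) by apply Rmax_l.
  assert (Wa : Cmod (coord 1 z) <= W) by (eapply Rle_trans; [apply Rmax_l|apply Rmax_r]).
  assert (Wb : Cmod (coord 2 z) <= W) by (eapply Rle_trans; [apply Rmax_r|apply Rmax_r]).
  assert (S : size3 z <= K * W).
  { assert (E : Cmod al * Cmod (coord 0 z) <= A + Cmod be * Cmod (coord 1 z) + Cmod ga * Cmod (coord 2 z)).
    { rewrite <- !Cmod_Cmul.
      pose proof (Cmod_tri (Cmul al (coord 0 z)) (lin al be ga z)) as T.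
      rewrite (Cmod_Csub_sym (Cmul al (coord 0 z))) in T.
      replace (Csub (lin al be ga z) (Cmul al (coord 0 z)))
        with (Cadd (Cmul be (coord 1 z)) (Cmul ga (coord 2 z))) in T
        by (unfold lin, Cadd, Csub; simpl; f_equal; ring).
      pose proof (Cmod_Cadd (Cmul be (coord 1 z)) (Cmul ga (coord 2 z))). lra. }
    pose proof (Cmod_ge0 be); pose proof (Cmod_ge0 ga).
    assert (E2 : Cmod al * Cmod (coord 0 z) <= Cmod al * (c * W)).
    { replace (Cmod al * (c * W)) with ((A + Cmod be + Cmod ga) * W) by (unfold c; field; lra). nra. }
    apply Rmult_le_reg_l in E2; [|assumption].
    unfold size3, K. lra. }
  eapply Rle_trans; [exact S|]. apply Rmult_le_compat_l; [unfold K; lra|].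
  unfold W in S |- *.
  destruct (Rle_lt_dec (Rmax (Cmod (coord 1 z)) (Cmod (coord 2 z))) 1) as [C|C].
  - rewrite (Rmax_left 1) by exact C. apply Rmax_l.
  - rewrite (Rmax_right 1) in S |- * by lra.
    eapply Rle_trans; [|apply Rmax_r].
    destruct (Rle_lt_dec (Cmod (coord 1 z)) (Cmod (coord 2 z))) as [F|F].
    + rewrite Rmax_right in S, C |- * by exact F.
      eapply Rle_trans; [|apply Rmax_r]. apply (H3 z Zp); [lra|exact S].
    + rewrite Rmax_left in S, C |- * by lra.
      eapply Rle_trans; [|apply Rmax_l]. apply (H2 z Zq); [lra|exact S].
Qed.

Definition mform (mu : Cx) (z : C3) : Cx := Cadd (coord 1 z) (Cmul mu (coord 2 z)).

(** Equality of the forms for two different slopes determines both coordinates, so a point differing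
    from [w] in them is confused with [w] for at most one [n]. *)
Lemma separating_slope (w : C3) (L : list C3) :
  exists n0 : nat, forall n, (n0 <= n)%nat -> forall z, In z L ->
    mform (INR n, 0) z = mform (INR n, 0) w -> coord 1 z = coord 1 w /\ coord 2 z = coord 2 w.
Proof.
  induction L as [|z L [n0 IH]]; [exists O; intros ? ? ? []|].
  assert (E : exists n1 : nat, forall n, (n1 <= n)%nat ->
    mform (INR n, 0) z = mform (INR n, 0) w -> coord 1 z = coord 1 w /\ coord 2 z = coord 2 w).
  { destruct (classic (exists m : nat, mform (INR m, 0) z = mform (INR m, 0) w)) as [[m Hm]|N].
    - exists (S m); intros n Hn Hn'.
      assert (INR n - INR m <> 0) by (apply lt_INR in Hn; lra).
      unfold mform, Cadd, Cmul in *.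
      destruct (coord 1 z) as [a b], (coord 2 z) as [c d], (coord 1 w) as [a' b'], (coord 2 w) as [c' d'].
      simpl in *. injection Hm as M1 M2. injection Hn' as N1 N2.
      assert (c = c').
      { apply Rminus_diag_uniq. apply Rmult_eq_reg_l with (INR n - INR m); [|assumption]. lra. }
      assert (d = d').
      { apply Rminus_diag_uniq. apply Rmult_eq_reg_l with (INR n - INR m); [|assumption]. lra. }
      subst. split; f_equal; lra.
    - exists O; intros n _ Hn; exfalso; apply N; exists n; exact Hn. }
  destruct E as [n1 E]. exists (Nat.max n0 n1); intros n Hn y [<-|Hy] Hm.
  - apply (E n); [lia|exact Hm].
  - apply (IH n); [lia|exact Hy|exact Hm].
Qed.

(** The fibre is bounded, so a sufficiently large value is missed; it serves as the certificate [b0]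
    of the elimination lemmas. *)
Lemma mform_escape al be ga a mu : al <> Czero ->
  exists b0, forall z, Z z -> lin al be ga z = a -> mform mu z <> b0.
Proof.
  intros Hal. destruct (fiber_bounded al be ga (Cmod a) Hal (Cmod_ge0 a)) as [M HM].
  exists (M + Cmod mu * M + 1, 0). intros z Hz Hl Hb.
  assert (S : size3 z <= M) by (apply HM; [exact Hz|rewrite Hl; lra]).
  assert (E : Cmod (mform mu z) <= M + Cmod mu * M).
  { unfold mform. eapply Rle_trans; [apply Cmod_Cadd|]. rewrite Cmod_Cmul.
    pose proof (Cmod_coord_le 1 z); pose proof (Cmod_coord_le 2 z); pose proof (Cmod_ge0 mu).
    assert (Cmod mu * Cmod (coord 2 z) <= Cmod mu * M) by (apply Rmult_le_compat_l; lra). lra. }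
  rewrite Hb in E. pose proof (abs_fst_le (M + Cmod mu * M + 1, 0)) as F; simpl in F.
  pose proof (Rle_abs (M + Cmod mu * M + 1)). lra.
Qed.

Lemma lin_cv al be ga u l : cv3 u l -> cvC (fun n => lin al be ga (u n)) (lin al be ga l).
Proof.
  intros H. unfold lin. apply cvC_add; [|apply cvC_add]; (apply cvC_mul; [apply cvC_const|apply H]).
Qed.

Lemma zero_cv u l : cv3 u l -> (forall n, Z (u n)) -> Z l.
Proof.
  intros H HZ; split.
  - apply (cvC_unique (fun _ => Czero)); [|apply cvC_const].
    destruct (cvC_peval (perturb 2 D eta k3 p) u l H) as [A B]; split.
    + apply is_lim_seq_ext with (2 := A); intros n; destruct (HZ n) as [E _]; rewrite E; reflexivity.
    + apply is_lim_seq_ext with (2 := B); intros n; destruct (HZ n) as [E _]; rewrite E; reflexivity.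
  - apply (cvC_unique (fun _ => Czero)); [|apply cvC_const].
    destruct (cvC_peval (perturb 1 D eta k2 q) u l H) as [A B]; split.
    + apply is_lim_seq_ext with (2 := A); intros n; destruct (HZ n) as [_ E]; rewrite E; reflexivity.
    + apply is_lim_seq_ext with (2 := B); intros n; destruct (HZ n) as [_ E]; rewrite E; reflexivity.
Qed.

Lemma Cmod_real x : 0 <= x -> Cmod (x, 0) = x.
Proof.
  intros Hx. unfold Cmod; simpl. replace (x * (x * 1) + 0 * (0 * 1)) with (x * x) by ring.
  apply sqrt_square; exact Hx.
Qed.

(** Choose the slope [mu] so that [z1] is the only point of its fibre with its value of [mform mu].
    Persistence gives zeros over [a1 + t] with nearby [mform]; they are bounded, and a limit point
    has the same linear form and the same [mform] as [z1], hence is [z1]. *)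
Lemma zero_continuation al be ga z1 : al <> Czero -> Z z1 ->
  exists u : nat -> C3, cv3 u z1 /\ forall n, Z (u n) /\
    exists t, 0 < t /\ lin al be ga (u n) = Cadd (lin al be ga z1) (t, 0).
Proof.
  intros Hal Hz1. set (a1 := lin al be ga z1).
  (* Finiteness of the fibre is obtained with the provisional slope 1; only afterwards can a
     separating slope be selected. *)
  assert (C1 : (1, 0) <> Czero) by (intros E; injection E; lra).
  destruct (mform_escape al be ga a1 (1, 0) Hal) as [b0 Hb0].
  destruct (Elimination.fiber_finite p q D eta k2 k3 al be ga (1, 0) b0 a1 Hp Hq Heta Hal C1 Hb0)
    as [L HL].
  destruct (separating_slope z1 L) as [n0 Hn0].
  (* [S n0] rather than [n0], because the slope must be nonzero. *)
  set (mu := (INR (S n0), 0)).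
  assert (Hmu : mu <> Czero).
  { intros E; apply (f_equal fst) in E; unfold mu, Czero in E; cbn [fst] in E.
    rewrite S_INR in E; pose proof (pos_INR n0); lra. }
  destruct (mform_escape al be ga a1 mu Hal) as [b1 Hb1].
  assert (E : forall n : nat, exists z, Z z /\
     (exists t, 0 < t <= / (INR n + 1) /\ lin al be ga z = Cadd a1 (t, 0)) /\
     Cmod (Csub (mform mu z) (mform mu z1)) < / (INR n + 1)).
  { intros n.
    destruct (Elimination.fiber_persistence p q D eta k2 k3 al be ga mu b1 z1 Hp Hq Heta Hal Hmu Hz1 Hb1
      (/ (INR n + 1)) (inv_S_pos n)) as [d [d0 Hd]].
    pose proof (inv_S_pos n).
    set (t := Rmin (d / 2) (/ (INR n + 1))).
    assert (t0 : 0 < t) by (unfold t; apply Rmin_glb_lt; lra).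
    destruct (Hd (Cadd a1 (t, 0))) as [z [Hz [Hl Hm]]].
    - replace (Csub (Cadd a1 (t, 0)) (lin al be ga z1)) with (t, 0)
        by (unfold a1, Csub, Cadd; simpl; f_equal; ring).
      rewrite Cmod_real by lra. unfold t; eapply Rle_lt_trans; [apply Rmin_l|lra].
    - exists z; split; [exact Hz|split; [|exact Hm]].
      exists t; split; [split; [exact t0|apply Rmin_r]|exact Hl]. }
  set (w := fun n => proj1_sig (constructive_indefinite_description _ (E n))).
  assert (Hw : forall n, Z (w n) /\
     (exists t, 0 < t <= / (INR n + 1) /\ lin al be ga (w n) = Cadd a1 (t, 0)) /\
     Cmod (Csub (mform mu (w n)) (mform mu z1)) < / (INR n + 1))
    by (intros n; unfold w; destruct constructive_indefinite_description; assumption).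
  destruct (fiber_bounded al be ga (Cmod a1 + 1) Hal) as [M HM]; [pose proof (Cmod_ge0 a1); lra|].
  destruct (bw_C3 w M) as [s [Hs [l Hl]]].
  { intros n i. destruct (Hw n) as [Hz [[t [Ht Hlin]] _]].
    eapply Rle_trans; [apply Cmod_coord_le|]. apply HM; [exact Hz|rewrite Hlin].
    eapply Rle_trans; [apply Cmod_Cadd|]. rewrite Cmod_real by lra.
    pose proof (inv_S_le1 n).
    lra. }
  assert (Zl : Z l) by (apply (zero_cv (fun n => w (s n))); [exact Hl|intros n; apply Hw]).
  assert (Ll : lin al be ga l = a1).
  { apply (cvC_unique (fun n => lin al be ga (w (s n)))); [apply (lin_cv al be ga _ l Hl)|].
    apply (cvC_comp_ge (fun n => lin al be ga (w n)) a1 s Hs). apply cvC_of_Cmod.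
    apply lim_squeeze0 with (2 := is_lim_seq_inv_S). intros n; split; [apply Cmod_ge0|].
    destruct (Hw n) as [_ [[t [Ht Hlin]] _]]. rewrite Hlin.
    replace (Csub (Cadd a1 (t, 0)) a1) with (t, 0) by (unfold Csub, Cadd; simpl; f_equal; ring).
    rewrite Cmod_real; lra. }
  assert (Ml : mform mu l = mform mu z1).
  { apply (cvC_unique (fun n => mform mu (w (s n)))).
    - unfold mform; apply cvC_add; [apply Hl|apply cvC_mul; [apply cvC_const|apply Hl]].
    - apply (cvC_comp_ge (fun n => mform mu (w n)) _ s Hs). apply cvC_of_Cmod.
      apply lim_squeeze0 with (2 := is_lim_seq_inv_S). intros n; split; [apply Cmod_ge0|].
      left; apply Hw. }
  destruct (Hn0 (S n0) (Nat.le_succ_diag_r n0) l (HL l Zl Ll) Ml) as [E1 E2].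
  assert (E0 : coord 0 l = coord 0 z1).
  { unfold a1, lin in Ll. rewrite E1, E2 in Ll.
    assert (F : Cmul al (Csub (coord 0 l) (coord 0 z1)) = Czero).
    { revert Ll; generalize (Cmul be (coord 1 z1)) (Cmul ga (coord 2 z1)) (coord 0 l) (coord 0 z1).
      intros x y a b. destruct x, y, a, b, al; unfold Cadd, Csub, Cmul, Czero; simpl.
      intros H; injection H; intros; f_equal; lra. }
    apply Cmul_Czero in F; destruct F as [F|F]; [contradiction|apply Csub_eq; exact F]. }
  assert (El : l = z1).
  { destruct l as [[a b] c], z1 as [[a' b'] c']; simpl in *; congruence. }
  subst l. exists (fun n => w (s n)); split; [exact Hl|].
  intros n; destruct (Hw (s n)) as [Hz [[t [Ht Hlin]] _]]; split; [exact Hz|].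
  exists t; split; [lra|exact Hlin].
Qed.

(** * Heights over the paraboloid and crossing of levels *)

Definition xr (j : nat) (z : C3) : R :=
  match j with
  | 0%nat => snd (coord 0 z)
  | 1%nat => fst (coord 1 z)
  | 2%nat => snd (coord 1 z)
  | 3%nat => fst (coord 2 z)
  | _ => snd (coord 2 z)
  end.

Definition sum5 (f : nat -> R) : R := f 0%nat + f 1%nat + f 2%nat + f 3%nat + f 4%nat.

(* Straightens the paraboloid [Re z1 = - (Im z1)^2 - |z2|^2 - |z3|^2] to a level set. *)
Definition height (z : C3) : R := fst (coord 0 z) + sum5 (fun j => xr j z ^ 2).

Definition qdist (b : nat -> R) (z : C3) : R := sum5 (fun j => (xr j z - b j) ^ 2).

(** The complex linear form whose real part is the linearization of [height] at the coordinates [b],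
    up to a constant. The defect [qdist b] expresses strict convexity: on one level, larger real
    part means closer to [b]. The [z1]-coefficient is never 0, so the fibre results apply to every
    [b]. *)
Definition tangent (b : nat -> R) : C3 -> Cx :=
  lin (1, - (2 * b 0%nat)) (2 * b 1%nat, - (2 * b 2%nat)) (2 * b 3%nat, - (2 * b 4%nat)).

Lemma fst_tangent b z : fst (tangent b z) = height z - qdist b z + sum5 (fun j => b j ^ 2).
Proof. unfold tangent, lin, height, qdist, sum5, Cadd, Cmul; simpl; ring. Qed.

Lemma qdist_ge0 b z : 0 <= qdist b z.
Proof.
  unfold qdist, sum5. repeat apply Rplus_le_le_0_compat; apply pow2_ge_0.
Qed.

Lemma xr_cv j u l : cv3 u l -> is_lim_seq (fun n => xr j (u n)) (xr j l).
Proof.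
  intros H; destruct j as [|[|[|[|j]]]].
  - exact (proj2 (H 0%nat)).
  - exact (proj1 (H 1%nat)).
  - exact (proj2 (H 1%nat)).
  - exact (proj1 (H 2%nat)).
  - exact (proj2 (H 2%nat)).
Qed.

Lemma is_lim_seq_sqr u (l : R) : is_lim_seq u l -> is_lim_seq (fun n => u n ^ 2) (l ^ 2).
Proof.
  intros H. apply is_lim_seq_ext with (fun n => u n * u n); [intros; ring|].
  replace (l ^ 2) with (l * l) by ring. apply is_lim_seq_mult'; exact H.
Qed.

Lemma height_cv u l : cv3 u l -> is_lim_seq (fun n => height (u n)) (height l).
Proof.
  intros H. unfold height, sum5. apply is_lim_seq_plus'; [exact (proj1 (H 0%nat))|].
  do 4 (apply is_lim_seq_plus'; [|apply is_lim_seq_sqr, xr_cv; exact H]).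
  apply is_lim_seq_sqr, xr_cv; exact H.
Qed.

(* Follow the zero curve while [tangent b] increases; it is trapped below the level [e]
   only in a compact region, so it must cross that level. *)
Lemma level_crossing (b : nat -> R) (e : R) (zs : C3) : Z zs -> height zs <= e ->
  exists z, Z z /\ height z = e /\ height zs - qdist b zs <= e - qdist b z.
Proof.
  intros Hzs He. set (as_ := tangent b zs).
  assert (Hal : (1, - (2 * b 0%nat)) <> Czero) by (intros E; injection E; lra).
  (* Values reached by any point of the curve below the level, not along a chosen path: a supremum
     attained by compactness replaces the construction of a path. *)
  set (T := fun t => 0 <= t /\ exists z, Z z /\ tangent b z = Cadd as_ (t, 0) /\ height z <= e).
  assert (Tub : forall t, T t -> t <= e + sum5 (fun j => b j ^ 2) - fst as_).
  { intros t [t0 [z [Hz [Hl Hh]]]]. apply (f_equal fst) in Hl. rewrite fst_tangent in Hl.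
    unfold Cadd in Hl; cbn [fst] in Hl. pose proof (qdist_ge0 b z). lra. }
  destruct (completeness T) as [t1 [Hub Hlub]].
  { exists (e + sum5 (fun j => b j ^ 2) - fst as_); intros t Ht; apply Tub; exact Ht. }
  { exists 0; split; [lra|]. exists zs; split; [exact Hzs|split; [|exact He]].
    unfold as_; destruct (tangent b zs); unfold Cadd; simpl; f_equal; ring. }
  assert (E : forall n : nat, exists z, Z z /\ height z <= e /\
     exists t, 0 <= t /\ t1 - / (INR n + 1) < t <= t1 /\ tangent b z = Cadd as_ (t, 0)).
  { intros n. pose proof (inv_S_pos n).
    destruct (classic (exists t, T t /\ t1 - / (INR n + 1) < t)) as [[t [[t0 [z [Hz [Hl Hh]]]] Ht]]|N].
    - exists z; split; [exact Hz|split; [exact Hh|exists t; split; [exact t0|split; [split|]]]]; auto.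
      apply Hub; split; [exact t0|exists z; auto].
    - exfalso. assert (t1 <= t1 - / (INR n + 1)); [|lra].
      apply Hlub. intros t Ht. apply Rnot_lt_le; intros C. apply N; exists t; auto. }
  set (w := fun n => proj1_sig (constructive_indefinite_description _ (E n))).
  assert (Hw : forall n, Z (w n) /\ height (w n) <= e /\
     exists t, 0 <= t /\ t1 - / (INR n + 1) < t <= t1 /\ tangent b (w n) = Cadd as_ (t, 0))
    by (intros n; unfold w; destruct constructive_indefinite_description; assumption).
  assert (t10 : 0 <= t1) by (destruct (Hw O) as [_ [_ [t Ht]]]; lra).
  destruct (fiber_bounded _ (2 * b 1%nat, - (2 * b 2%nat)) (2 * b 3%nat, - (2 * b 4%nat))
     (Cmod as_ + t1) Hal) as [M HM]; [pose proof (Cmod_ge0 as_); lra|].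
  destruct (bw_C3 w M) as [s [Hs [l Hl]]].
  { intros n i. destruct (Hw n) as [Hz [_ [t [t0 [Ht Hlin]]]]].
    eapply Rle_trans; [apply Cmod_coord_le|]. apply HM; [exact Hz|]. fold (tangent b). rewrite Hlin.
    eapply Rle_trans; [apply Cmod_Cadd|]. rewrite Cmod_real by lra. lra. }
  assert (Zl : Z l) by (apply (zero_cv (fun n => w (s n))); [exact Hl|intros n; apply Hw]).
  assert (Ll : tangent b l = Cadd as_ (t1, 0)).
  { apply (cvC_unique (fun n => tangent b (w (s n)))); [apply (lin_cv _ _ _ _ l Hl)|].
    apply (cvC_comp_ge (fun n => tangent b (w n)) _ s Hs). apply cvC_of_Cmod.
    apply lim_squeeze0 with (2 := is_lim_seq_inv_S). intros n; split; [apply Cmod_ge0|].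
    destruct (Hw n) as [_ [_ [t [t0 [Ht Hlin]]]]]. rewrite Hlin, Cmod_Csub_sym.
    replace (Csub (Cadd as_ (t1, 0)) (Cadd as_ (t, 0))) with (t1 - t, 0)
      by (unfold Csub, Cadd; simpl; f_equal; ring).
    rewrite Cmod_real; lra. }
  assert (Hh : height l <= e).
  { apply (is_lim_seq_le (fun n => height (w (s n))) (fun _ => e) (height l) e).
    - intros n; apply Hw.
    - apply height_cv; exact Hl.
    - apply is_lim_seq_const. }
  assert (Heq : height l = e).
  { destruct (Rle_lt_or_eq_dec _ _ Hh) as [Hlt|Heq]; [exfalso|exact Heq].
    destruct (zero_continuation _ (2 * b 1%nat, - (2 * b 2%nat)) (2 * b 3%nat, - (2 * b 4%nat)) l Hal Zl)
      as [u [Hu Hun]].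
    pose proof (height_cv u l Hu) as Hc. apply is_lim_seq_spec in Hc.
    destruct (Hc (mkposreal (e - height l) ltac:(lra))) as [N HN]. specialize (HN N (Nat.le_refl N)).
    simpl in HN. apply Rabs_def2 in HN.
    destruct (Hun N) as [HZ [t [t0 Ht]]]. fold (tangent b) in Ht. rewrite Ll in Ht.
    assert (t1 + t <= t1); [|lra]. apply Hub. split; [lra|].
    exists (u N); split; [exact HZ|split; [|lra]]. rewrite Ht.
    unfold Cadd; simpl; f_equal; ring. }
  exists l; split; [exact Zl|split; [exact Heq|]].
  apply (f_equal fst) in Ll. unfold as_, Cadd in Ll. cbn [fst] in Ll. rewrite !fst_tangent, Heq in Ll. lra.
Qed.

End Good.

(** * Compactness of the space of binary sequences *)

Definition agree (n : nat) (s t : nat -> bool) : Prop := forall i, (i < n)%nat -> s i = t i.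

Lemma agree_sym n s t : agree n s t -> agree n t s.
Proof. intros H i Hi; symmetry; apply H; exact Hi. Qed.
Lemma agree_trans n s t u : agree n s t -> agree n t u -> agree n s u.
Proof. intros H G i Hi; rewrite H, G by exact Hi; reflexivity. Qed.
Lemma agree_le n m s t : (n <= m)%nat -> agree m s t -> agree n s t.
Proof. intros H G i Hi; apply G; lia. Qed.

Section Cluster.
Variable T : nat -> nat -> bool.

Definition recurrent (n : nat) (s : nat -> bool) : Prop :=
  forall N, exists k, (N <= k)%nat /\ agree n (T k) s.

Definition update (s : nat -> bool) (n : nat) (b : bool) : nat -> bool :=
  fun i => if Nat.eqb i n then b else s i.

(** The branch of König's lemma: the next bit is [true] whenever terms of arbitrarily large index
    share the prefix so extended, and otherwise [false] inherits this property. *)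
Fixpoint cluster_prefix (n : nat) : nat -> bool :=
  match n with
  | O => fun _ => true
  | S n => update (cluster_prefix n) n
             (if excluded_middle_informative (recurrent (S n) (update (cluster_prefix n) n true))
              then true else false)
  end.

Lemma agree_update n s t b : agree n s t -> s n = b -> agree (S n) s (update t n b).
Proof.
  intros H E i Hi. unfold update. destruct (Nat.eqb_spec i n) as [->|N]; [exact E|apply H; lia].
Qed.

Lemma cluster_prefix_recurrent n : recurrent n (cluster_prefix n).
Proof.
  induction n as [|n IH]; [intros N; exists N; split; [lia|intros i Hi; lia]|].
  simpl. destruct excluded_middle_informative as [H|H]; [exact H|].
  apply not_all_ex_not in H; destruct H as [N0 H0].
  intros N. destruct (IH (Nat.max N N0)) as [k [Hk Ha]]. exists k; split; [lia|].
  apply agree_update; [exact Ha|]. destruct (T k n) eqn:E; [|reflexivity].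
  exfalso; apply H0; exists k; split; [lia|apply agree_update; assumption].
Qed.

Lemma cluster_prefix_agree n m : (n <= m)%nat -> agree n (cluster_prefix m) (cluster_prefix n).
Proof.
  induction 1 as [|m H IH]; [intros i Hi; reflexivity|].
  intros i Hi. simpl. unfold update at 1. destruct (Nat.eqb_spec i m); [lia|apply IH; exact Hi].
Qed.

Lemma cantor_cluster : exists (s : nat -> nat) (t : nat -> bool),
  (forall n, (n <= s n)%nat) /\ forall n, agree n (T (s n)) t.
Proof.
  assert (E : forall n, exists k, (n <= k)%nat /\ agree n (T k) (cluster_prefix n))
    by (intros n; apply cluster_prefix_recurrent).
  set (s := fun n => proj1_sig (constructive_indefinite_description _ (E n))).
  assert (Hs : forall n, (n <= s n)%nat /\ agree n (T (s n)) (cluster_prefix n))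
    by (intros n; unfold s; destruct constructive_indefinite_description; assumption).
  exists s, (fun n => cluster_prefix (S n) n). split; [intros n; apply Hs|].
  intros n i Hi. rewrite (proj2 (Hs n)) by exact Hi.
  rewrite (cluster_prefix_agree (S i) n) by lia. reflexivity.
Qed.
End Cluster.

(** * The raised Cantor set *)

Fixpoint psum (a : nat -> R) (n : nat) : R :=
  match n with O => 0 | S n => psum a n + a n end.

Lemma psum_ext a b n : (forall k, (k < n)%nat -> a k = b k) -> psum a n = psum b n.
Proof.
  induction n as [|n IH]; intros H; simpl; [reflexivity|].
  rewrite IH, H; auto.
Qed.

Lemma psum_sum_f_R0 a n : psum a (S n) = sum_f_R0 a n.
Proof. induction n as [|n IH]; simpl in *; [ring|rewrite IH; reflexivity]. Qed.

Lemma series_tail (a : nat -> R) (B r : R) : 0 <= r < 1 -> (forall k, Rabs (a k) <= B * r ^ k) ->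
  forall n, Rabs (Series a - psum a n) <= B * r ^ n / (1 - r).
Proof.
  intros Hr Ha n.
  assert (Hr' : Rabs r < 1) by (rewrite Rabs_pos_eq; lra).
  assert (Eg : forall c, ex_series (fun k => c * r ^ k)).
  { intros c. apply (ex_series_scal c (fun k => r ^ k)). apply ex_series_geom; exact Hr'. }
  assert (Sg : forall c, Series (fun k => c * r ^ k) = c / (1 - r)).
  { intros c. rewrite Series_scal_l, Series_geom by exact Hr'. field; lra. }
  assert (Ea : ex_series a).
  { apply (ex_series_le a (fun k => B * r ^ k)); [exact Ha|apply Eg]. }
  assert (Et : Series a - psum a n = Series (fun k => a (n + k)%nat)).
  { destruct n as [|n]; [simpl; rewrite Rminus_0_r; apply Series_ext; reflexivity|].
    rewrite (Series_incr_n a (S n)) by (auto; lia). rewrite psum_sum_f_R0; simpl pred. ring. }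
  assert (Hb : forall k, Rabs (a (n + k)%nat) <= (B * r ^ n) * r ^ k).
  { intros k. rewrite Rmult_assoc, <- pow_add. apply Ha. }
  rewrite Et. eapply Rle_trans; [apply Series_Rabs|].
  - apply (ex_series_le (fun k => Rabs (a (n + k)%nat)) (fun k => (B * r ^ n) * r ^ k)); [|apply Eg].
    intros k; simpl. unfold norm; simpl. unfold abs; simpl. rewrite Rabs_Rabsolu. apply Hb.
  - rewrite <- Sg. apply Series_le; [|apply Eg]. intros k; split; [apply Rabs_pos|apply Hb].
Qed.

Definition bit (t : nat -> bool) (i : nat) : R := if t i then 1 else 0.

Lemma bit_bound t i : 0 <= bit t i <= 1.
Proof. unfold bit; destruct (t i); lra. Qed.

(* Each stage consumes 15 bits of [t], three for each of the five coordinates; the resulting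
   eight intervals of radius 1/8 around the digits cover [-1, 1]. *)
Definition digit (t : nat -> bool) (j n : nat) : R :=
  (2 * (4 * bit t (15 * n + 3 * j) + 2 * bit t (15 * n + 3 * j + 1) + bit t (15 * n + 3 * j + 2)) - 7) / 8.

Definition phi_term (t : nat -> bool) (j n : nat) : R := digit t j n * (1 / 2) ^ n.
(** Base-4 digits restricted to 0 and 1: a digit at place [i] weighs [4^-i / 16], all later ones
    together at most [4^-i / 48], so [eps] is injective. The overlapping expansions [phi] are
    not. *)
Definition eps_term (t : nat -> bool) (i : nat) : R := bit t i / 16 * (1 / 4) ^ i.

Definition phi (t : nat -> bool) (j : nat) : R := Series (phi_term t j).
Definition eps (t : nat -> bool) : R := Series (eps_term t).

Lemma digit_bound t j n : Rabs (digit t j n) <= 1.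
Proof.
  unfold digit. pose proof (bit_bound t (15 * n + 3 * j)); pose proof (bit_bound t (15 * n + 3 * j + 1));
  pose proof (bit_bound t (15 * n + 3 * j + 2)). apply Rabs_le; lra.
Qed.

Lemma phi_tail t j n : Rabs (phi t j - psum (phi_term t j) n) <= 2 * (1 / 2) ^ n.
Proof.
  replace (2 * (1 / 2) ^ n) with (1 * (1 / 2) ^ n / (1 - 1 / 2)) by field.
  apply series_tail; [lra|]. intros k. unfold phi_term. rewrite Rabs_mult.
  rewrite (Rabs_pos_eq ((1 / 2) ^ k)) by (apply pow_le; lra).
  apply Rmult_le_compat_r; [apply pow_le; lra|apply digit_bound].
Qed.

Lemma eps_tail t n : Rabs (eps t - psum (eps_term t) n) <= 1 / 12 * (1 / 4) ^ n.
Proof.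
  replace (1 / 12 * (1 / 4) ^ n) with (1 / 16 * (1 / 4) ^ n / (1 - 1 / 4)) by field.
  apply series_tail; [lra|]. intros k. unfold eps_term. pose proof (bit_bound t k).
  assert (0 <= (1 / 4) ^ k) by (apply pow_le; lra).
  rewrite Rabs_pos_eq by (apply Rmult_le_pos; lra).
  apply Rmult_le_compat_r; lra.
Qed.

Lemma phi_agree n s t j : (j < 5)%nat -> agree (15 * n) s t ->
  psum (phi_term s j) n = psum (phi_term t j) n.
Proof.
  intros Hj H. apply psum_ext. intros k Hk. unfold phi_term, digit, bit.
  rewrite !H by lia. reflexivity.
Qed.

Lemma eps_agree n s t : agree n s t -> psum (eps_term s) n = psum (eps_term t) n.
Proof.
  intros H. apply psum_ext. intros k Hk. unfold eps_term, bit. rewrite H by lia. reflexivity.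
Qed.

Lemma eps_bound t : Rabs (eps t) <= 1 / 12.
Proof. pose proof (eps_tail t 0) as H; simpl in H. rewrite Rminus_0_r in H. lra. Qed.

Lemma first_difference (s t : nat -> bool) : s <> t -> exists i, agree i s t /\ s i <> t i.
Proof.
  intros H. assert (E : exists i, s i <> t i).
  { apply not_all_ex_not. intros E; apply H; extensionality i; apply E. }
  destruct E as [i Hi]. revert Hi. induction i as [i IH] using lt_wf_ind. intros Hi.
  destruct (classic (agree i s t)) as [A|A]; [exists i; auto|].
  apply not_all_ex_not in A; destruct A as [k A]. apply imply_to_and in A.
  apply (IH k); apply A.
Qed.

Lemma eps_inj s t : eps s = eps t -> s = t.
Proof.
  intros E. apply NNPP; intros N. destruct (first_difference s t N) as [i [A D]].
  pose proof (eps_tail s (S i)) as Ts. pose proof (eps_tail t (S i)) as Tt.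
  simpl in Ts, Tt. rewrite (eps_agree i s t A) in Ts. unfold eps_term at 2 in Ts. unfold eps_term at 2 in Tt.
  assert (P : 0 < (1 / 4) ^ i) by (apply pow_lt; lra).
  apply Rabs_le_between in Ts; apply Rabs_le_between in Tt.
  unfold bit in Ts, Tt. destruct (s i), (t i); try congruence; lra.
Qed.

(** The first real part is solved from [height = eps t], so distinct points lie on distinct
    levels. *)
Definition cpt (t : nat -> bool) : C3 :=
  ((eps t - sum5 (fun j => phi t j ^ 2), phi t 0%nat), (phi t 1%nat, phi t 2%nat), (phi t 3%nat, phi t 4%nat)).

Lemma xr_cpt t j : (j < 5)%nat -> xr j (cpt t) = phi t j.
Proof. intros H; destruct j as [|[|[|[|[|j]]]]]; simpl; [..|lia]; reflexivity. Qed.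

Lemma height_cpt t : height (cpt t) = eps t.
Proof. unfold height, cpt, sum5; simpl; ring. Qed.

Lemma cpt_inj s t : cpt s = cpt t -> s = t.
Proof. intros H; apply eps_inj; rewrite <- !height_cpt, H; reflexivity. Qed.

Lemma cv3_of_coordinates u l :
  (forall j, (j < 5)%nat -> is_lim_seq (fun n => xr j (u n)) (xr j l)) ->
  is_lim_seq (fun n => height (u n)) (height l) -> cv3 u l.
Proof.
  intros Hx Hh.
  assert (H0 : is_lim_seq (fun n => fst (coord 0 (u n))) (fst (coord 0 l))).
  { apply is_lim_seq_ext with (fun n => height (u n) - sum5 (fun j => xr j (u n) ^ 2)).
    - intros n; unfold height; ring.
    - replace (fst (coord 0 l)) with (height l - sum5 (fun j => xr j l ^ 2)) by (unfold height; ring).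
      apply is_lim_seq_minus'; [exact Hh|]. unfold sum5.
      do 4 (apply is_lim_seq_plus'; [|apply is_lim_seq_sqr, Hx; lia]).
      apply is_lim_seq_sqr, Hx; lia. }
  intros [|[|i]]; split.
  - exact H0.
  - apply (Hx 0%nat); lia.
  - apply (Hx 1%nat); lia.
  - apply (Hx 2%nat); lia.
  - apply (Hx 3%nat); lia.
  - apply (Hx 4%nat); lia.
Qed.

Lemma lim_of_bound (u : nat -> R) (l K r : R) : 0 <= r < 1 ->
  (forall n, Rabs (u n - l) <= K * r ^ n) -> is_lim_seq u l.
Proof.
  intros Hr H.
  apply is_lim_seq_ext with (fun n => (u n - l) + l); [intros; ring|].
  replace (Finite l) with (Finite (0 + l)) by (f_equal; ring).
  apply is_lim_seq_plus'; [|apply is_lim_seq_const].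
  apply is_lim_seq_abs_0. apply lim_squeeze0 with (fun n => K * r ^ n).
  - intros n; split; [apply Rabs_pos|apply H].
  - replace (Finite 0) with (Finite (K * 0)) by (f_equal; ring).
    apply is_lim_seq_mult'; [apply is_lim_seq_const|apply is_lim_seq_geom; rewrite Rabs_pos_eq; lra].
Qed.

Lemma cpt_cv (T : nat -> nat -> bool) t : (forall n, agree (15 * n) (T n) t) ->
  cv3 (fun n => cpt (T n)) (cpt t).
Proof.
  intros HT. apply cv3_of_coordinates.
  - intros j Hj. rewrite xr_cpt by exact Hj. apply lim_of_bound with 4 (1 / 2); [lra|].
    intros n. rewrite xr_cpt by exact Hj. pose proof (phi_tail (T n) j n) as A.
    rewrite (phi_agree n (T n) t j Hj (HT n)) in A.
    pose proof (phi_tail t j n) as B.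
    apply Rabs_le_between in A; apply Rabs_le_between in B; apply Rabs_le; lra.
  - rewrite height_cpt. apply lim_of_bound with 1 (1 / 4); [lra|].
    intros n. rewrite height_cpt. pose proof (eps_tail (T n) n) as A.
    rewrite (eps_agree n (T n) t) in A by (apply agree_le with (2 := HT n); lia).
    pose proof (eps_tail t n) as B. assert (0 < (1 / 4) ^ n) by (apply pow_lt; lra).
    apply Rabs_le_between in A; apply Rabs_le_between in B; apply Rabs_le; lra.
Qed.

Lemma cpt_cluster (T : nat -> nat -> bool) : exists (s : nat -> nat) (t : nat -> bool),
  (forall n, (n <= s n)%nat) /\ (forall n, agree (15 * n) (T (s n)) t) /\
  cv3 (fun n => cpt (T (s n))) (cpt t).
Proof.
  destruct (cantor_cluster T) as [s [t [Hs Ht]]].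
  exists (fun n => s (15 * n)%nat), t. split; [|split].
  - intros n; specialize (Hs (15 * n)%nat); lia.
  - intros n; apply Ht.
  - apply (cpt_cv (fun n => T (s (15 * n)%nat))). intros n; apply Ht.
Qed.

Lemma cpt_bounded : exists M, forall t, size3 (cpt t) <= M.
Proof.
  assert (P : forall t j, Rabs (phi t j) <= 2).
  { intros t j. pose proof (phi_tail t j 0) as H; simpl in H. rewrite Rminus_0_r in H. lra. }
  assert (E : forall t, Rabs (eps t) <= 1).
  { intros t. pose proof (eps_bound t); lra. }
  exists 100. intros t. unfold size3.
  assert (A : Cmod (coord 0 (cpt t)) <= 23).
  { eapply Rle_trans; [apply Cmod_le_sum|]. unfold cpt; cbn [coord fst snd].
    pose proof (P t 0%nat) as P0; pose proof (P t 1%nat) as P1; pose proof (P t 2%nat) as P2;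
    pose proof (P t 3%nat) as P3; pose proof (P t 4%nat) as P4; pose proof (E t) as E0.
    apply Rabs_le_between in E0. assert (Rabs (eps t - sum5 (fun j => phi t j ^ 2)) <= 21); [|lra].
    apply Rabs_le_between in P0; apply Rabs_le_between in P1; apply Rabs_le_between in P2;
    apply Rabs_le_between in P3; apply Rabs_le_between in P4.
    assert (Q : forall x, -2 <= x <= 2 -> 0 <= x ^ 2 <= 4) by (intros; nra).
    apply Q in P0; apply Q in P1; apply Q in P2; apply Q in P3; apply Q in P4.
    unfold sum5; apply Rabs_le; lra. }
  assert (B : Cmod (coord 1 (cpt t)) <= 4).
  { eapply Rle_trans; [apply Cmod_le_sum|]. unfold cpt; cbn [coord fst snd].
    pose proof (P t 1%nat); pose proof (P t 2%nat); lra. }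
  assert (C : Cmod (coord 2 (cpt t)) <= 4).
  { eapply Rle_trans; [apply Cmod_le_sum|]. unfold cpt; cbn [coord fst snd].
    pose proof (P t 3%nat); pose proof (P t 4%nat); lra. }
  lra.
Qed.

(** * Trapping a curve in shrinking caps *)

Lemma digit_approx x : Rabs x <= 1 -> exists b : nat -> bool,
  Rabs (x - (2 * (4 * bit b 0 + 2 * bit b 1 + bit b 2) - 7) / 8) <= 1 / 8.
Proof.
  intros Hx. apply Rabs_le_between in Hx. unfold bit.
  assert (E : forall b0 b1 b2 : bool,
    Rabs (x - (2 * (4 * (if b0 then 1 else 0) + 2 * (if b1 then 1 else 0) + (if b2 then 1 else 0)) - 7) / 8) <= 1 / 8 ->
    exists b : nat -> bool,
    Rabs (x - (2 * (4 * (if b 0%nat then 1 else 0) + 2 * (if b 1%nat then 1 else 0) + (if b 2%nat then 1 else 0)) - 7) / 8) <= 1 / 8).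
  { intros b0 b1 b2 H. exists (fun n => match n with O => b0 | 1%nat => b1 | _ => b2 end). exact H. }
  destruct (Rle_lt_dec x (-3/4)); [apply (E false false false); apply Rabs_le; lra|].
  destruct (Rle_lt_dec x (-2/4)); [apply (E false false true); apply Rabs_le; lra|].
  destruct (Rle_lt_dec x (-1/4)); [apply (E false true false); apply Rabs_le; lra|].
  destruct (Rle_lt_dec x 0); [apply (E false true true); apply Rabs_le; lra|].
  destruct (Rle_lt_dec x (1/4)); [apply (E true false false); apply Rabs_le; lra|].
  destruct (Rle_lt_dec x (2/4)); [apply (E true false true); apply Rabs_le; lra|].
  destruct (Rle_lt_dec x (3/4)); [apply (E true true false); apply Rabs_le; lra|].
  apply (E true true true); apply Rabs_le; lra.
Qed.

Lemma eps_psum_increment t m k :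
  0 <= psum (eps_term t) (m + k) - psum (eps_term t) m <= 1 / 12 * ((1 / 4) ^ m - (1 / 4) ^ (m + k)).
Proof.
  induction k as [|k IH].
  - rewrite Nat.add_0_r; lra.
  - rewrite Nat.add_succ_r.
    change (psum (eps_term t) (S (m + k))) with (psum (eps_term t) (m + k) + eps_term t (m + k)).
    change ((1 / 4) ^ S (m + k)) with (1 / 4 * (1 / 4) ^ (m + k)).
    assert (0 < (1 / 4) ^ (m + k)) by (apply pow_lt; lra).
    assert (0 <= eps_term t (m + k) <= 1 / 16 * (1 / 4) ^ (m + k))
      by (unfold eps_term; pose proof (bit_bound t (m + k)); nra).
    lra.
Qed.

Lemma pow_antitone r m n : 0 <= r <= 1 -> (m <= n)%nat -> r ^ n <= r ^ m.
Proof.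
  intros Hr. induction 1 as [|n H IH]; [lra|]. simpl.
  assert (0 <= r ^ n) by (apply pow_le; lra). nra.
Qed.

(** The curve meets a cap of radius [(1/2)^n] whose centre and level depend on the same [15 n] bits:
    [n] digits in each of five coordinates. *)
Definition stage (Z : C3 -> Prop) (n : nat) : Prop := exists t z, Z z /\
  height z = psum (eps_term t) (15 * n) /\ qdist (fun j => psum (phi_term t j) n) z <= (1 / 4) ^ n.

Lemma qdist_coord b z r j : (j < 5)%nat -> 0 <= r -> qdist b z <= r ^ 2 -> Rabs (xr j z - b j) <= r.
Proof.
  intros Hj Hr H. unfold qdist, sum5 in H.
  pose proof (pow2_ge_0 (xr 0 z - b 0%nat)); pose proof (pow2_ge_0 (xr 1 z - b 1%nat));
  pose proof (pow2_ge_0 (xr 2 z - b 2%nat)); pose proof (pow2_ge_0 (xr 3 z - b 3%nat));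
  pose proof (pow2_ge_0 (xr 4 z - b 4%nat)).
  assert (E : (xr j z - b j) ^ 2 <= r ^ 2) by (destruct j as [|[|[|[|[|j]]]]]; [..|lia]; lra).
  apply Rabs_le; split; nra.
Qed.

Section Stages.
Variables (p q : poly3) (D : nat) (eta k2 k3 : Cx).
Hypotheses (Hp : (pdeg p < D)%nat) (Hq : (pdeg q < D)%nat) (Heta : eta <> Czero).
Let Z := common_zero (perturb 2 D eta k3 p) (perturb 1 D eta k2 q).

(** The next 15 bits put the new centre within [1/8 * 2^-n] of [z] in each coordinate. Crossing the
    raised level then increases the squared distance by at most the rise, and
    [5/64 + 1/12 < 1/4]. *)
Lemma stage_step n : stage Z n -> stage Z (S n).
Proof.
  intros [t [z [Hz [Hh Hq0]]]].
  assert (P2 : 0 < (1 / 2) ^ n) by (apply pow_lt; lra).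
  assert (P4 : (1 / 4) ^ n = (1 / 2) ^ n * (1 / 2) ^ n)
    by (rewrite <- Rpow_mult_distr; f_equal; field).
  assert (Hb : forall j, exists b : nat -> bool, (j < 5)%nat ->
    Rabs ((xr j z - psum (phi_term t j) n) / (1 / 2) ^ n
      - (2 * (4 * bit b 0 + 2 * bit b 1 + bit b 2) - 7) / 8) <= 1 / 8).
  { intros j. destruct (Nat.lt_ge_cases j 5) as [Hj|Hj]; [|exists (fun _ => true); lia].
    destruct (digit_approx ((xr j z - psum (phi_term t j) n) / (1 / 2) ^ n)) as [b Hb].
    - unfold Rdiv. rewrite Rabs_mult, (Rabs_pos_eq (/ (1 * / 2) ^ n)) by (left; apply Rinv_0_lt_compat; exact P2).
      apply Rmult_le_reg_r with ((1 / 2) ^ n); [exact P2|].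
      rewrite Rmult_assoc. fold (1 / 2). rewrite Rinv_l, Rmult_1_r, Rmult_1_l by lra.
      apply (qdist_coord (fun j => psum (phi_term t j) n)); [exact Hj|lra|]. nra.
    - exists b; intros _; exact Hb. }
  set (be := fun j => proj1_sig (constructive_indefinite_description _ (Hb j))).
  assert (Hbe : forall j, (j < 5)%nat ->
    Rabs ((xr j z - psum (phi_term t j) n) / (1 / 2) ^ n
      - (2 * (4 * bit (be j) 0 + 2 * bit (be j) 1 + bit (be j) 2) - 7) / 8) <= 1 / 8)
    by (intros j; unfold be; destruct constructive_indefinite_description; assumption).
  (* The quotient by 3 selects the coordinate and the remainder its bit. From place [15 n + 15] on
     the values are arbitrary, since stage [S n] reads only earlier bits. *)
  set (t' := fun i => if (i <? 15 * n)%nat then t i else be ((i - 15 * n) / 3)%nat ((i - 15 * n) mod 3)%nat).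
  assert (At : agree (15 * n) t' t).
  { intros i Hi. unfold t'. apply Nat.ltb_lt in Hi; rewrite Hi; reflexivity. }
  assert (Bt : forall j k, (k < 3)%nat -> t' (15 * n + 3 * j + k)%nat = be j k).
  { intros j k Hk. unfold t'. destruct (Nat.ltb_spec (15 * n + 3 * j + k) (15 * n)); [lia|].
    replace (15 * n + 3 * j + k - 15 * n)%nat with (k + j * 3)%nat by lia.
    rewrite Nat.div_add, Nat.Div0.mod_add, Nat.div_small, Nat.mod_small by lia. reflexivity. }
  assert (Dg : forall j, (j < 5)%nat -> (xr j z - psum (phi_term t' j) (S n)) ^ 2 <= (1 / 4) ^ n / 64).
  { intros j Hj. simpl psum. rewrite (phi_agree n t' t j Hj At). unfold phi_term at 2.
    assert (Ed : digit t' j n = (2 * (4 * bit (be j) 0 + 2 * bit (be j) 1 + bit (be j) 2) - 7) / 8).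
    { unfold digit, bit. rewrite <- (Nat.add_0_r (15 * n + 3 * j)) at 1. rewrite !Bt by lia. reflexivity. }
    specialize (Hbe j Hj). rewrite <- Ed in Hbe.
    set (x := xr j z - psum (phi_term t j) n) in *.
    replace (xr j z - (psum (phi_term t j) n + digit t' j n * (1 / 2) ^ n))
      with ((x / (1 / 2) ^ n - digit t' j n) * (1 / 2) ^ n) by (unfold x; field; lra).
    rewrite P4, Rpow_mult_distr. apply Rabs_le_between in Hbe.
    set (v := x / (1 / 2) ^ n - digit t' j n) in *. assert (v ^ 2 <= 1 / 64) by nra.
    assert (0 <= (1 / 2) ^ n * (1 / 2) ^ n) by nra. nra. }
  assert (Ei : 0 <= psum (eps_term t') (15 * S n) - psum (eps_term t) (15 * n) <= 1 / 12 * (1 / 4) ^ n).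
  { rewrite <- (eps_agree (15 * n) t' t At). replace (15 * S n)%nat with (15 * n + 15)%nat by lia.
    pose proof (eps_psum_increment t' (15 * n) 15) as I.
    assert ((1 / 4) ^ (15 * n) <= (1 / 4) ^ n) by (rewrite pow_mult; apply pow_incr; simpl; lra).
    assert (0 < (1 / 4) ^ (15 * n + 15)) by (apply pow_lt; lra). lra. }
  destruct (level_crossing p q D eta k2 k3 Hp Hq Heta (fun j => psum (phi_term t' j) (S n))
     (psum (eps_term t') (15 * S n)) z Hz) as [z' [Hz' [Hh' Hq']]]; [lra|].
  exists t', z'. split; [exact Hz'|split; [exact Hh'|]].
  assert (Qz : qdist (fun j => psum (phi_term t' j) (S n)) z <= 5 * ((1 / 4) ^ n / 64)).
  { unfold qdist, sum5. pose proof (Dg 0%nat ltac:(lia)); pose proof (Dg 1%nat ltac:(lia));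
    pose proof (Dg 2%nat ltac:(lia)); pose proof (Dg 3%nat ltac:(lia)); pose proof (Dg 4%nat ltac:(lia)). lra. }
  assert (0 < (1 / 4) ^ n) by (apply pow_lt; lra).
  change ((1 / 4) ^ S n) with (1 / 4 * (1 / 4) ^ n). lra.
Qed.

(** Its height [-1/4] is below every [eps t], as [|eps t| <= 1/12], yet close enough to 0 for a
    curve through it to meet the initial cap. Its last two coordinates vanish, so perturbing with
    [k = 0] and [D > 0] keeps it on the curve. *)
Definition base_point : C3 := ((- / 4, 0), (0, 0), (0, 0)).

(** The bit sequences of successive stages cluster at some [t]; the curve points in the
    corresponding caps converge to [cpt t], and the zero set is closed. *)
Lemma perturbed_zero_on_cantor : Z base_point -> exists t, Z (cpt t).
Proof.
  intros H0.
  assert (S0 : stage Z 0).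
  { destruct (level_crossing p q D eta k2 k3 Hp Hq Heta (fun _ => 0) 0 base_point H0) as [z [Hz [Hh Hd]]].
    - unfold height, sum5, base_point; simpl; lra.
    - exists (fun _ => true), z. split; [exact Hz|split; [simpl; exact Hh|]].
      simpl. change (qdist (fun _ => 0) z <= 1). revert Hd. unfold height, qdist at 1, sum5, base_point; simpl.
      intros Hd; lra. }
  assert (Sn : forall n, stage Z n) by (induction n; [exact S0|apply stage_step; assumption]).
  set (T := fun n => proj1_sig (constructive_indefinite_description _ (Sn n))).
  assert (HT : forall n, exists z, Z z /\ height z = psum (eps_term (T n)) (15 * n) /\
    qdist (fun j => psum (phi_term (T n) j) n) z <= (1 / 4) ^ n)
    by (intros n; unfold T; destruct constructive_indefinite_description; assumption).
  destruct (cpt_cluster T) as [s [t [Hs [Ha _]]]]. exists t.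
  set (u := fun n => proj1_sig (constructive_indefinite_description _ (HT (s n)))).
  assert (Hu : forall n, Z (u n) /\ height (u n) = psum (eps_term (T (s n))) (15 * s n) /\
    qdist (fun j => psum (phi_term (T (s n)) j) (s n)) (u n) <= (1 / 4) ^ s n)
    by (intros n; unfold u; destruct constructive_indefinite_description; assumption).
  apply (zero_cv p q D eta k2 k3 u); [|intros n; apply Hu].
  assert (Pw : forall n, (1 / 2) ^ s n <= (1 / 2) ^ n).
  { intros n. apply pow_antitone; [lra|apply Hs]. }
  apply cv3_of_coordinates.
  (* [7 = 1 + 2 + 2 + 2]: the cap radius and three tails of [phi]. *)
  - intros j Hj. rewrite xr_cpt by exact Hj. apply lim_of_bound with 7 (1 / 2); [lra|]. intros n.
    destruct (Hu n) as [_ [_ Hd]].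
    assert (A : Rabs (xr j (u n) - psum (phi_term (T (s n)) j) (s n)) <= (1 / 2) ^ s n).
    { apply (qdist_coord (fun j => psum (phi_term (T (s n)) j) (s n))); [exact Hj|apply pow_le; lra|].
      rewrite <- pow_mult, Nat.mul_comm, pow_mult. eapply Rle_trans; [exact Hd|].
      apply Req_le; f_equal; field. }
    pose proof (phi_tail (T (s n)) j (s n)) as B.
    pose proof (phi_tail (T (s n)) j n) as B1. pose proof (phi_tail t j n) as B2.
    rewrite (phi_agree n (T (s n)) t j Hj (Ha n)) in B1. specialize (Pw n).
    apply Rabs_le_between in A; apply Rabs_le_between in B; apply Rabs_le_between in B1;
    apply Rabs_le_between in B2; apply Rabs_le; lra.
  - rewrite height_cpt. apply lim_of_bound with 1 (1 / 4); [lra|]. intros n.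
    destruct (Hu n) as [_ [Hh _]]. rewrite Hh.
    pose proof (eps_tail (T (s n)) (15 * s n)) as B. pose proof (eps_tail (T (s n)) n) as B1.
    pose proof (eps_tail t n) as B2.
    rewrite (eps_agree n (T (s n)) t) in B1 by (apply agree_le with (2 := Ha n); lia).
    assert (P : (1 / 4) ^ (15 * s n) <= (1 / 4) ^ n).
    { apply pow_antitone; [lra|specialize (Hs n); lia]. }
    assert (0 < (1 / 4) ^ n) by (apply pow_lt; lra).
    apply Rabs_le_between in B; apply Rabs_le_between in B1;
    apply Rabs_le_between in B2; apply Rabs_le; lra.
Qed.
End Stages.

(** * Removing the perturbation *)

Lemma Cmod_lim_zero (u : nat -> C3) l p (v : nat -> R) : cv3 u l ->
  (forall n, Cmod (peval p (u n)) <= v n) -> is_lim_seq v 0 -> peval p l = Czero.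
Proof.
  intros Hu Hb Hv. apply Cmod_eq0.
  assert (L1 := cvC_Cmod _ _ (cvC_peval p u l Hu)).
  assert (L2 : is_lim_seq (fun n => Cmod (peval p (u n))) 0).
  { apply lim_squeeze0 with (2 := Hv). intros n; split; [apply Cmod_ge0|apply Hb]. }
  apply is_lim_seq_unique in L1; apply is_lim_seq_unique in L2. rewrite L1 in L2; injection L2; auto.
Qed.

Lemma perturb_zero_le i D n p z M : (0 < D)%nat -> size3 z <= M ->
  peval (perturb i D (/ (INR n + 1), 0) Czero p) z = Czero ->
  Cmod (peval p z) <= M ^ D * / (INR n + 1).
Proof.
  intros HD HM H. pose proof (inv_S_pos n).
  unfold perturb in H; cbn [peval] in H.
  assert (E : peval p z = Csub Czero (Cmul (/ (INR n + 1), 0) (peval (PPow (PVar i) D) z))).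
  { revert H. generalize (peval p z) (peval (PPow (PVar i) D) z). intros [a b] [c d].
    unfold Cadd, Csub, Cmul, Czero; simpl. intros H1; injection H1; intros; f_equal; lra. }
  rewrite E, Cmod_Csub_sym.
  replace (Csub (Cmul (/ (INR n + 1), 0) (peval (PPow (PVar i) D) z)) Czero)
    with (Cmul (/ (INR n + 1), 0) (peval (PPow (PVar i) D) z))
    by (unfold Csub, Czero, Cmul; simpl; f_equal; ring).
  rewrite Cmod_Cmul, Cmod_real, peval_pow by lra. rewrite Rmult_comm.
  apply Rmult_le_compat_r; [lra|]. apply pow_incr; split; [apply Cmod_ge0|].
  eapply Rle_trans; [apply Cmod_coord_le|exact HM].
Qed.

(** With [eta = 1/(n+1)] the perturbed systems have zeros [cpt t_n]. These stay bounded, so [p] and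
    [q] are [O(1/n)] there and vanish at a cluster point. *)
Theorem common_zero_on_cantor p q : common_zero p q base_point -> exists t, common_zero p q (cpt t).
Proof.
  intros [Hp Hq]. set (D := S (pdeg p + pdeg q)).
  assert (E : forall n : nat, exists t,
    common_zero (perturb 2 D (/ (INR n + 1), 0) Czero p) (perturb 1 D (/ (INR n + 1), 0) Czero q) (cpt t)).
  { intros n. apply perturbed_zero_on_cantor; [unfold D; lia|unfold D; lia| |].
    - intros C; injection C; pose proof (inv_S_pos n); lra.
    - split; unfold perturb; cbn [peval].
      + rewrite Hp. unfold D; simpl. unfold Cadd, Cmul, Czero; simpl; f_equal; ring.
      + rewrite Hq. unfold D; simpl. unfold Cadd, Cmul, Czero; simpl; f_equal; ring. }
  set (T := fun n => proj1_sig (constructive_indefinite_description _ (E n))).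
  assert (HT : forall n,
    common_zero (perturb 2 D (/ (INR n + 1), 0) Czero p) (perturb 1 D (/ (INR n + 1), 0) Czero q) (cpt (T n)))
    by (intros n; unfold T; destruct constructive_indefinite_description; assumption).
  destruct (cpt_cluster T) as [s [t [Hs [_ Hc]]]]. exists t.
  destruct cpt_bounded as [M HM].
  assert (L : is_lim_seq (fun n => M ^ D * / (INR (s n) + 1)) 0).
  { replace (Finite 0) with (Finite (M ^ D * 0)) by (f_equal; ring).
    apply is_lim_seq_mult'; [apply is_lim_seq_const|].
    apply (is_lim_seq_comp_ge (fun n => / (INR n + 1)) 0 s Hs is_lim_seq_inv_S). }
  split; apply (Cmod_lim_zero _ _ _ _ Hc) with (2 := L); intros n;
    eapply perturb_zero_le; try apply HM; try (unfold D; lia); apply (HT (s n)).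
Qed.

(** * A countable dense family of polynomials *)

Definition drat (x : nat) : R :=
  let (ab, s) := Cantor.of_nat x in let (a, b) := Cantor.of_nat ab in (INR a - INR b) / (INR s + 1).

Definition dconst (c : nat) : Cx := let (x, y) := Cantor.of_nat c in (drat x, drat y).

(** Codes are decoded as syntax trees of depth at most [fuel]. Both subtrees receive the same fuel,
    so density is proved for every sufficiently large fuel, which allows two approximations to be
    combined. *)
Fixpoint dpoly (fuel c : nat) : poly3 :=
  match fuel with
  | O => PConst (dconst c)
  | S f => let (k, m) := Cantor.of_nat c in
           match k with
           | 0%nat => PConst (dconst m)
           | 1%nat => PVar m
           | 2%nat => let (x, y) := Cantor.of_nat m in PAdd (dpoly f x) (dpoly f y)
           | _ => let (x, y) := Cantor.of_nat m in PMul (dpoly f x) (dpoly f y)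
           end
  end.

Definition poly_enum (n : nat) : poly3 := let (f, c) := Cantor.of_nat n in dpoly f c.

Lemma drat_dense x e : 0 < e -> exists n, Rabs (drat n - x) <= e.
Proof.
  intros He.
  destruct (archimed_cor1 e He) as [s [Hs Hs0]].
  destruct s as [|s]; [lia|]. rewrite S_INR in Hs. pose proof (pos_INR s) as P.
  destruct (archimed (x * (INR s + 1))) as [U1 U2].
  set (k := up (x * (INR s + 1))) in *.
  exists (Cantor.to_nat (Cantor.to_nat (Z.to_nat k, Z.to_nat (- k)), s)).
  unfold drat. rewrite !Cantor.cancel_of_to.
  assert (E : INR (Z.to_nat k) - INR (Z.to_nat (- k)) = IZR k).
  { destruct (Z.le_gt_cases 0 k).
    - replace (Z.to_nat (- k)) with O by lia. rewrite INR_IZR_INZ, Z2Nat.id by lia. simpl; ring.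
    - replace (Z.to_nat k) with O by lia. rewrite (INR_IZR_INZ (Z.to_nat (- k))), Z2Nat.id by lia.
      rewrite opp_IZR; simpl; ring. }
  rewrite E. replace (IZR k / (INR s + 1) - x) with ((IZR k - x * (INR s + 1)) * / (INR s + 1)) by (field; lra).
  pose proof (inv_S_pos s).
  rewrite Rabs_mult, (Rabs_pos_eq (/ (INR s + 1))) by lra.
  assert (Rabs (IZR k - x * (INR s + 1)) <= 1) by (apply Rabs_le; lra). nra.
Qed.

Lemma dconst_dense a e : 0 < e -> exists n, Cmod (Csub (dconst n) a) <= e.
Proof.
  intros He. destruct (drat_dense (fst a) (e / 2)) as [x Hx]; [lra|].
  destruct (drat_dense (snd a) (e / 2)) as [y Hy]; [lra|].
  exists (Cantor.to_nat (x, y)). unfold dconst. rewrite Cantor.cancel_of_to.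
  eapply Rle_trans; [apply Cmod_le_sum|]. simpl. lra.
Qed.

Lemma peval_bounded_on p M : exists B, 0 <= B /\ forall z, size3 z <= M -> Cmod (peval p z) <= B.
Proof.
  destruct (peval_growth p) as [K [K0 H]]. exists (K * Rabs M ^ pdeg p); split.
  - apply Rmult_le_pos; [exact K0|apply pow_le, Rabs_pos].
  - intros z Hz. eapply Rle_trans; [apply H|]. apply Rmult_le_compat_l; [exact K0|].
    apply pow_incr; split; [pose proof (size3_ge1 z); lra|]. pose proof (Rle_abs M); lra.
Qed.

Lemma Csub_add_split a b c d :
  Cmod (Csub (Cadd a b) (Cadd c d)) <= Cmod (Csub a c) + Cmod (Csub b d).
Proof.
  replace (Csub (Cadd a b) (Cadd c d)) with (Cadd (Csub a c) (Csub b d))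
    by (unfold Csub, Cadd; simpl; f_equal; ring).
  apply Cmod_Cadd.
Qed.

Lemma Csub_mul_split a b c d :
  Cmod (Csub (Cmul a b) (Cmul c d)) <= Cmod (Csub a c) * Cmod b + Cmod c * Cmod (Csub b d).
Proof.
  replace (Csub (Cmul a b) (Cmul c d)) with (Cadd (Cmul (Csub a c) b) (Cmul c (Csub b d)))
    by (unfold Csub, Cadd, Cmul; simpl; f_equal; ring).
  rewrite <- !Cmod_Cmul. apply Cmod_Cadd.
Qed.

Lemma Csub_diag a : Csub a a = Czero.
Proof. unfold Csub, Czero; f_equal; ring. Qed.

Lemma dpoly_dense M p : forall e, 0 < e -> exists f0, forall f, (f0 <= f)%nat ->
  exists c, forall z, size3 z <= M -> Cmod (Csub (peval (dpoly f c) z) (peval p z)) <= e.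
Proof.
  induction p as [a|i|p IHp q IHq|p IHp q IHq]; intros e He.
  - destruct (dconst_dense a e He) as [n Hn]. exists O. intros [|f] _.
    + exists n; intros z _; exact Hn.
    + exists (Cantor.to_nat (0%nat, n)); intros z _. cbn [dpoly].
      rewrite Cantor.cancel_of_to. exact Hn.
  - exists 1%nat; intros [|f] Hf; [lia|].
    exists (Cantor.to_nat (1%nat, i)); intros z _. cbn [dpoly].
    rewrite Cantor.cancel_of_to. rewrite Csub_diag, Cmod_Czero; lra.
  - destruct (IHp (e / 2)) as [f1 H1]; [lra|]. destruct (IHq (e / 2)) as [f2 H2]; [lra|].
    exists (S (Nat.max f1 f2)); intros [|f] Hf; [lia|].
    destruct (H1 f) as [c1 E1]; [lia|]. destruct (H2 f) as [c2 E2]; [lia|].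
    exists (Cantor.to_nat (2%nat, Cantor.to_nat (c1, c2))); intros z Hz. cbn [dpoly].
    rewrite !Cantor.cancel_of_to. cbn [peval].
    eapply Rle_trans; [apply Csub_add_split|]. specialize (E1 z Hz); specialize (E2 z Hz); lra.
  - destruct (peval_bounded_on p M) as [B [B0 HB]]. destruct (peval_bounded_on q M) as [C [C0 HC]].
    set (d := Rmin 1 (e / (B + C + 1))).
    assert (d0 : 0 < d) by (apply Rmin_glb_lt; [lra|apply Rdiv_lt_0_compat; lra]).
    assert (d1 : d <= 1) by apply Rmin_l.
    assert (d2 : d * (B + C + 1) <= e).
    { apply Rle_trans with (e / (B + C + 1) * (B + C + 1)).
      - apply Rmult_le_compat_r; [lra|apply Rmin_r].
      - apply Req_le; field; lra. }
    destruct (IHp d d0) as [f1 H1]. destruct (IHq d d0) as [f2 H2].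
    exists (S (Nat.max f1 f2)); intros [|f] Hf; [lia|].
    destruct (H1 f) as [c1 E1]; [lia|]. destruct (H2 f) as [c2 E2]; [lia|].
    exists (Cantor.to_nat (3%nat, Cantor.to_nat (c1, c2))); intros z Hz. cbn [dpoly].
    rewrite !Cantor.cancel_of_to. cbn [peval].
    eapply Rle_trans; [apply Csub_mul_split|].
    specialize (E1 z Hz); specialize (E2 z Hz); specialize (HB z Hz); specialize (HC z Hz).
    pose proof (Cmod_tri (peval (dpoly f c2) z) (peval q z)).
    pose proof (Cmod_ge0 (Csub (peval (dpoly f c1) z) (peval p z))).
    pose proof (Cmod_ge0 (Csub (peval (dpoly f c2) z) (peval q z))).
    pose proof (Cmod_ge0 (peval p z)). pose proof (Cmod_ge0 (peval (dpoly f c2) z)).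
    apply Rle_trans with (d * (C + 1) + B * d); [|lra].
    apply Rplus_le_compat; apply Rmult_le_compat; lra.
Qed.

Lemma poly_enum_dense M p e : 0 < e ->
  exists n, forall z, size3 z <= M -> Cmod (Csub (peval (poly_enum n) z) (peval p z)) <= e.
Proof.
  intros He. destruct (dpoly_dense M p e He) as [f H]. destruct (H f (Nat.le_refl f)) as [c Hc].
  exists (Cantor.to_nat (f, c)). unfold poly_enum. rewrite Cantor.cancel_of_to. exact Hc.
Qed.

(** * The decreasing sequence of peak conditions *)

Lemma half_plane_contraction R0 : 0 <= R0 -> exists m r, 0 < m /\ 0 <= r < 1 /\
  forall w, fst w <= - (1 / 2) -> Cmod w <= R0 -> Cmod (Cadd Cone (Cmul (/ m, 0) w)) <= r.
Proof.
  (* From [|1 + w/m|^2 = 1 + 2 Re w / m + |w|^2 / m^2], the middle term is at most [-1/m], and this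
     [m] makes the last at most [1/(2m)]. *)
  intros HR. set (m := 2 * (R0 * R0) + 1). assert (m1 : 1 <= m) by (unfold m; nra).
  assert (i0 : 0 < / m) by (apply Rinv_0_lt_compat; lra).
  assert (im : / m * m = 1) by (apply Rinv_l; lra).
  assert (i1 : / m <= 1) by nra.
  exists m, (sqrt (1 - / m / 2)). split; [lra|split; [split|]].
  - apply sqrt_pos.
  - rewrite <- sqrt_1 at 2. apply sqrt_lt_1_alt; lra.
  - intros w Hw HM. unfold Cmod at 1. apply sqrt_le_1_alt.
    pose proof (Cmod_sqr w) as Q. pose proof (Cmod_ge0 w).
    assert (Q2 : Cmod w * Cmod w <= R0 * R0) by nra. rewrite Q in Q2.
    destruct w as [a b]. unfold Cadd, Cmul, Cone; cbn [fst snd] in *.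
    set (i := / m) in *.
    assert (A : i * i * (a * a + b * b) <= i / 2).
    { apply Rle_trans with (i * i * (m / 2)).
      - apply Rmult_le_compat_l; [nra|]. unfold m; lra.
      - replace (i * i * (m / 2)) with (i * (i * m) / 2) by field. rewrite im. lra. }
    assert (B : i * a <= i * - (1 / 2)) by (apply Rmult_le_compat_l; lra).
    nra.
Qed.

Lemma pow_small r e : 0 <= r < 1 -> 0 < e -> exists n : nat, r ^ n < e.
Proof.
  intros Hr He. destruct (pow_lt_1_zero r) with (y := e) as [N HN]; [rewrite Rabs_pos_eq; lra|exact He|].
  exists N. specialize (HN N (Nat.le_refl N)). rewrite Rabs_pos_eq in HN; [exact HN|apply pow_le; lra].
Qed.

Lemma peval_bounded p : exists B, 0 <= B /\ forall t, Cmod (peval p (cpt t)) <= B.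
Proof.
  destruct cpt_bounded as [M HM]. destruct (peval_bounded_on p M) as [B [B0 HB]].
  exists B; split; [exact B0|intros t; apply HB, HM].
Qed.

Lemma Cmul_comm a b : Cmul a b = Cmul b a.
Proof. unfold Cmul; f_equal; ring. Qed.
Lemma Cmul_assoc a b c : Cmul a (Cmul b c) = Cmul (Cmul a b) c.
Proof. unfold Cmul; simpl; f_equal; ring. Qed.
Lemma Cmul_one a : Cmul Cone a = a.
Proof. destruct a; unfold Cmul, Cone; simpl; f_equal; ring. Qed.

Lemma Cinv_right a : a <> Czero -> Cmul a (Cinv a) = Cone.
Proof. exact (Cinv_r a). Qed.

Lemma peval_pow_one p n z : peval p z = Cone -> peval (PPow p n) z = Cone.
Proof.
  intros H; induction n; simpl; [reflexivity|]. rewrite H, IHn. apply Cmul_one.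
Qed.

(* With [Re f' >= 1/2] replacing [Re f >= 1/2] the condition gets stronger and makes
   [e] invertible: [f'] is [e] times a high power of [1 + (f - 1)/m]. *)
Lemma refine_peak (f e : poly3) : peval f base_point = Cone -> exists f',
  peval f' base_point = Cone /\
  (forall t, 1 / 2 <= fst (peval f' (cpt t)) -> 1 / 2 <= fst (peval f (cpt t))) /\
  (peval e base_point <> Czero -> exists E, forall z, peval f' z = Cmul (peval e z) (peval E z)).
Proof.
  intros Hf. destruct (classic (peval e base_point = Czero)) as [E0|E0].
  { exists f; split; [exact Hf|split; [auto|intros C; contradiction]]. }
  set (w := PAdd f (PConst (-1, 0))).
  destruct (peval_bounded w) as [R0 [R00 HR]].
  destruct (half_plane_contraction R0 R00) as [m [r [m0 [Hr Hc]]]].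
  set (g := PAdd (PConst Cone) (PMul (PConst (/ m, 0)) w)).
  set (c := Cinv (peval e base_point)).
  destruct (peval_bounded e) as [B [B0 HB]].
  (* Where [Re f < 1/2] the new polynomial is bounded by [B |c| r^n]; this [n] brings it below
     [1/2]. The factor [c] normalizes the value at [base_point] to 1. *)
  destruct (pow_small r (/ (2 * (B * Cmod c + 1)))) as [n Hn]; [exact Hr| |].
  { apply Rinv_0_lt_compat. pose proof (Cmod_ge0 c). nra. }
  set (E := PMul (PConst c) (PPow g n)).
  exists (PMul e E). split; [|split].
  - assert (Hg : peval g base_point = Cone).
    { unfold g, w; cbn [peval]. rewrite Hf. unfold Cadd, Cmul, Cone; simpl; f_equal; ring. }
    unfold E; cbn [peval]. rewrite (peval_pow_one g n _ Hg), (Cmul_comm c), Cmul_one.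
    unfold c. apply Cinv_right; exact E0.
  - intros t Ht. apply Rnot_lt_le; intros Hlt.
    assert (Hg : Cmod (peval g (cpt t)) <= r).
    { apply Hc; [|apply HR]. change (fst (peval f (cpt t)) + -1 <= - (1 / 2)); lra. }
    assert (Hm : Cmod (peval (PMul e E) (cpt t)) < 1 / 2).
    { unfold E; cbn [peval]. rewrite !Cmod_Cmul, peval_pow.
      assert (P : Cmod (peval g (cpt t)) ^ n <= r ^ n) by (apply pow_incr; split; [apply Cmod_ge0|exact Hg]).
      pose proof (Cmod_ge0 c) as c0. specialize (HB t). pose proof (Cmod_ge0 (peval e (cpt t))).
      apply Rle_lt_trans with (B * (Cmod c * r ^ n)).
      - apply Rmult_le_compat; [assumption| |assumption|].
        + apply Rmult_le_pos; [exact c0|apply pow_le, Cmod_ge0].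
        + apply Rmult_le_compat_l; assumption.
      - assert (K : 0 < B * Cmod c + 1) by nra.
        apply Rle_lt_trans with ((B * Cmod c + 1) * r ^ n).
        + assert (0 <= r ^ n) by (apply pow_le; lra). nra.
        + apply Rlt_le_trans with ((B * Cmod c + 1) * / (2 * (B * Cmod c + 1))).
          * apply Rmult_lt_compat_l; assumption.
          * apply Req_le; field; lra. }
    pose proof (abs_fst_le (peval (PMul e E) (cpt t))). pose proof (Rle_abs (fst (peval (PMul e E) (cpt t)))).
    lra.
  - intros _; exists E; intros z; reflexivity.
Qed.

Definition peak_type := {f : poly3 | peval f base_point = Cone}.

Fixpoint peak_seq (n : nat) : peak_type :=
  match n with
  | O => exist _ (PConst Cone) eq_refl
  | S n => let f := peak_seq n in
      let d := constructive_indefinite_description _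
                 (refine_peak (proj1_sig f) (poly_enum n) (proj2_sig f)) in
      exist _ (proj1_sig d) (proj1 (proj2_sig d))
  end.

Definition peak (n : nat) : poly3 := proj1_sig (peak_seq n).

Lemma peak_base n : peval (peak n) base_point = Cone.
Proof. exact (proj2_sig (peak_seq n)). Qed.

Lemma peak_succ n :
  (forall t, 1 / 2 <= fst (peval (peak (S n)) (cpt t)) -> 1 / 2 <= fst (peval (peak n) (cpt t))) /\
  (peval (poly_enum n) base_point <> Czero ->
   exists E, forall z, peval (peak (S n)) z = Cmul (peval (poly_enum n) z) (peval E z)).
Proof.
  unfold peak; simpl. destruct constructive_indefinite_description as [f' H]; simpl. apply H.
Qed.

Lemma peak_mono n m t : (n <= m)%nat ->
  1 / 2 <= fst (peval (peak m) (cpt t)) -> 1 / 2 <= fst (peval (peak n) (cpt t)).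
Proof.
  induction 1 as [|m H IH]; [auto|]. intros Hm. apply IH. apply (peak_succ m); exact Hm.
Qed.

(** * A minimal set that still meets all zero sets *)

Definition closed_set (S : (nat -> bool) -> Prop) : Prop :=
  forall t, (forall n, exists s, S s /\ agree n s t) -> S t.

(** Applied to [p] minus its value at [base_point], this says that [p] takes that value on the set,
    which is stronger than [base_point] lying in the hull. By compactness it passes to decreasing
    intersections of closed sets. *)
Definition hits (S : (nat -> bool) -> Prop) : Prop :=
  forall q, peval q base_point = Czero -> exists t, S t /\ peval q (cpt t) = Czero.

Lemma peval_cpt_lim q (T : nat -> nat -> bool) t : cv3 (fun n => cpt (T n)) (cpt t) ->
  (forall n, peval q (cpt (T n)) = Czero) -> peval q (cpt t) = Czero.
Proof.
  intros Hc Hq. apply (Cmod_lim_zero _ _ _ (fun _ => 0) Hc).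
  - intros n; rewrite Hq, Cmod_Czero; lra.
  - apply is_lim_seq_const.
Qed.

Lemma fst_peval_lim_ge q c (T : nat -> nat -> bool) t : cv3 (fun n => cpt (T n)) (cpt t) ->
  (exists N, forall n, (N <= n)%nat -> c <= fst (peval q (cpt (T n)))) -> c <= fst (peval q (cpt t)).
Proof.
  intros Hc [N HN]. apply (is_lim_seq_le_loc (fun _ => c) (fun n => fst (peval q (cpt (T n)))) c (fst (peval q (cpt t)))).
  - exists N; exact HN.
  - apply is_lim_seq_const.
  - exact (proj1 (cvC_peval q _ _ Hc)).
Qed.

Definition peak_set (t : nat -> bool) : Prop := forall n, 1 / 2 <= fst (peval (peak n) (cpt t)).

Lemma peak_set_closed : closed_set peak_set.
Proof.
  intros t H n.
  set (T := fun k => proj1_sig (constructive_indefinite_description _ (H (15 * k)%nat))).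
  assert (HT : forall k, peak_set (T k) /\ agree (15 * k) (T k) t)
    by (intros k; unfold T; destruct constructive_indefinite_description; assumption).
  apply (fst_peval_lim_ge (peak n) _ T).
  - apply cpt_cv; intros k; apply HT.
  - exists O; intros k _; apply HT.
Qed.

(** The equations [peak k = 1] and [q = 0] both hold at [base_point], so they have a common zero on
    the Cantor set. By monotonicity it satisfies all peak conditions up to [k], and a cluster point
    satisfies them all. *)
Lemma peak_set_hits : hits peak_set.
Proof.
  intros q Hq.
  assert (E : forall k, exists t, common_zero (PAdd (peak k) (PConst (-1, 0))) q (cpt t)).
  { intros k. apply common_zero_on_cantor. split; [|exact Hq].
    simpl. rewrite peak_base. unfold Cadd, Cone, Czero; simpl; f_equal; ring. }
  set (T := fun k => proj1_sig (constructive_indefinite_description _ (E k))).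
  assert (HT : forall k, common_zero (PAdd (peak k) (PConst (-1, 0))) q (cpt (T k)))
    by (intros k; unfold T; destruct constructive_indefinite_description; assumption).
  destruct (cpt_cluster T) as [s [t [Hs [_ Hc]]]]. exists t; split.
  - intros n. apply (fst_peval_lim_ge (peak n) _ (fun k => T (s k)) t Hc).
    exists n; intros k Hk. apply (peak_mono n (s k)); [specialize (Hs k); lia|].
    destruct (HT (s k)) as [H1 _]. simpl in H1. apply (f_equal fst) in H1. simpl in H1. lra.
  - apply (peval_cpt_lim q (fun k => T (s k)) t Hc). intros k; apply (HT (s k)).
Qed.

Definition cylinder (n : nat) (t : nat -> bool) : Prop :=
  let (len, code) := Cantor.of_nat n in agree len t (Nat.testbit code).

Lemma cylinder_code t len : exists n, forall s, cylinder n s <-> agree len s t.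
Proof.
  assert (E : exists code, agree len (Nat.testbit code) t).
  { induction len as [|len [code IH]]; [exists O; intros i Hi; lia|].
    exists (if t len then Nat.setbit code len else Nat.clearbit code len).
    intros i Hi. destruct (t len) eqn:El.
    - rewrite Nat.setbit_eqb. destruct (Nat.eqb_spec len i) as [->|N]; [rewrite El; reflexivity|].
      simpl; apply IH; lia.
    - rewrite Nat.clearbit_eqb. destruct (Nat.eqb_spec len i) as [->|N].
      + rewrite El; apply Bool.andb_false_r.
      + simpl; rewrite Bool.andb_true_r. apply IH; lia. }
  destruct E as [code E]. exists (Cantor.to_nat (len, code)). intros s. unfold cylinder.
  rewrite Cantor.cancel_of_to. split; intros H.
  - apply agree_trans with (1 := H); exact E.
  - apply agree_trans with (1 := H); apply agree_sym; exact E.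
Qed.

Lemma cylinder_clopen n : exists len, forall s t, agree len s t -> (cylinder n s <-> cylinder n t).
Proof.
  unfold cylinder. destruct (Cantor.of_nat n) as [len code]. exists len. intros s t H. split; intros G.
  - apply agree_trans with (2 := G); apply agree_sym; exact H.
  - apply agree_trans with (2 := G); exact H.
Qed.

(** A countable greedy process in place of Zorn's lemma: each basic clopen set is examined once and
    discarded if what remains still has property [hits]. *)
Fixpoint shrink (n : nat) : (nat -> bool) -> Prop :=
  match n with
  | O => peak_set
  | S n => fun t => shrink n t /\ (hits (fun s => shrink n s /\ ~ cylinder n s) -> ~ cylinder n t)
  end.

Lemma shrink_mono n m t : (n <= m)%nat -> shrink m t -> shrink n t.
Proof. induction 1 as [|m H IH]; [auto|]. intros [H1 _]; auto. Qed.

Lemma shrink_hits n : hits (shrink n).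
Proof.
  induction n as [|n IH]; [exact peak_set_hits|].
  destruct (classic (hits (fun s => shrink n s /\ ~ cylinder n s))) as [H|H].
  - intros q Hq. destruct (H q Hq) as [t [[H1 H2] H3]]. exists t; simpl; auto.
  - intros q Hq. destruct (IH q Hq) as [t [H1 H2]]. exists t; simpl; split; [split; [auto|contradiction]|auto].
Qed.

Lemma shrink_closed n : closed_set (shrink n).
Proof.
  induction n as [|n IH]; [exact peak_set_closed|].
  intros t H; simpl; split.
  - apply IH. intros k. destruct (H k) as [s [[H1 _] H2]]. exists s; auto.
  - intros Hh C. destruct (cylinder_clopen n) as [len Hl].
    destruct (H len) as [s [[_ H1] H2]]. apply (H1 Hh). apply (Hl s t H2); exact C.
Qed.

Definition core (t : nat -> bool) : Prop := forall n, shrink n t.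

Lemma core_closed : closed_set core.
Proof.
  intros t H n. apply shrink_closed. intros k. destruct (H k) as [s [H1 H2]]. exists s; auto.
Qed.

Lemma core_hits : hits core.
Proof.
  intros q Hq.
  set (T := fun k => proj1_sig (constructive_indefinite_description _ (shrink_hits k q Hq))).
  assert (HT : forall k, shrink k (T k) /\ peval q (cpt (T k)) = Czero)
    by (intros k; unfold T; destruct constructive_indefinite_description; assumption).
  destruct (cpt_cluster T) as [s [t [Hs [Ha Hc]]]]. exists t; split.
  - intros n. apply shrink_closed. intros k. set (m := Nat.max n k). exists (T (s m)); split.
    + apply shrink_mono with (s m); [specialize (Hs m); lia|apply HT].
    + apply agree_le with (2 := Ha m); lia.
  - apply (peval_cpt_lim q (fun k => T (s k)) t Hc). intros k; apply HT.
Qed.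

Lemma base_point_not_cpt t : cpt t <> base_point.
Proof.
  intros H. apply (f_equal height) in H. rewrite height_cpt in H.
  unfold height, sum5, base_point in H; simpl in H.
  pose proof (eps_bound t) as E. apply Rabs_le_between in E. lra.
Qed.

Lemma C3_ext z w : (forall i, coord i z = coord i w) -> z = w.
Proof.
  intros H. pose proof (H 0%nat) as H0; pose proof (H 1%nat) as H1; pose proof (H 2%nat) as H2.
  destruct z as [[a b] c], w as [[a' b'] c']; simpl in *; congruence.
Qed.

Lemma separating_linear t : exists l, peval l base_point = Czero /\ peval l (cpt t) <> Czero.
Proof.
  assert (E : exists i, coord i (cpt t) <> coord i base_point).
  { apply not_all_ex_not. intros H. apply (base_point_not_cpt t).
    apply C3_ext; exact H. }
  destruct E as [i Hi].
  exists (PAdd (PVar i) (PConst (Csub Czero (coord i base_point)))); cbn [peval]; split.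
  - unfold Cadd, Csub, Czero; simpl; f_equal; ring.
  - intros H. apply Hi. revert H. generalize (coord i (cpt t)) (coord i base_point).
    intros [a b] [c d]. unfold Cadd, Csub, Czero; simpl. intros H; injection H; intros; f_equal; lra.
Qed.

Lemma bounded_below (S : (nat -> bool) -> Prop) q : closed_set S ->
  (forall t, S t -> peval q (cpt t) <> Czero) ->
  exists c, 0 < c /\ forall t, S t -> c <= Cmod (peval q (cpt t)).
Proof.
  intros HS Hq. apply NNPP; intros N.
  assert (E : forall n : nat, exists t, S t /\ Cmod (peval q (cpt t)) <= / (INR n + 1)).
  { intros n. apply NNPP; intros M. apply N. exists (/ (INR n + 1)); split; [apply inv_S_pos|].
    intros t Ht. apply Rnot_lt_le; intros C. apply M; exists t; split; [exact Ht|lra]. }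
  set (T := fun k => proj1_sig (constructive_indefinite_description _ (E k))).
  assert (HT : forall k, S (T k) /\ Cmod (peval q (cpt (T k))) <= / (INR k + 1))
    by (intros k; unfold T; destruct constructive_indefinite_description; assumption).
  destruct (cpt_cluster T) as [s [t [Hs [Ha Hc]]]]. apply (Hq t).
  - apply HS. intros k. exists (T (s k)); split; [apply HT|apply agree_le with (2 := Ha k); lia].
  - apply (Cmod_lim_zero _ _ _ (fun n => / (INR (s n) + 1)) Hc); [intros n; apply HT|].
    apply (is_lim_seq_comp_ge (fun n => / (INR n + 1)) 0 s Hs is_lim_seq_inv_S).
Qed.

(* An isolated point of [core] could be discarded: adding to [q] a small multiple of a
   linear form that vanishes at the base point moves the zero away from that point. *)
Lemma core_perfect t N : core t -> exists s, core s /\ agree N s t /\ s <> t.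
Proof.
  intros Ht. apply NNPP; intros C.
  destruct (cylinder_code t N) as [n Hn].
  assert (Iso : forall s, core s -> cylinder n s -> s = t).
  { intros s Hs Hc. apply NNPP; intros D. apply C; exists s; split; [exact Hs|split; [apply Hn; exact Hc|exact D]]. }
  assert (Cn : cylinder n t) by (apply Hn; intros i Hi; reflexivity).
  (* As [t] survived the examination of [cylinder n], discarding that cylinder must destroy [hits];
     a contradiction follows once it is shown not to. *)
  destruct (Ht (S n)) as [_ Hno]. apply Hno; [|exact Cn].
  intros q Hq.
  assert (E : exists s, (core s /\ ~ cylinder n s) /\ peval q (cpt s) = Czero).
  { apply NNPP; intros M.
    destruct (bounded_below (fun s => core s /\ ~ cylinder n s) q) as [c [c0 Hc]].
    - intros s H; split.
      + apply core_closed. intros k; destruct (H k) as [r [[H1 _] H2]]; exists r; auto.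
      + intros Cs. destruct (cylinder_clopen n) as [len Hl]. destruct (H len) as [r [[_ H1] H2]].
        apply H1, (Hl r s H2); exact Cs.
    - intros s Hs Hz. apply M; exists s; auto.
    - destruct (separating_linear t) as [l [Hl0 Hl1]]. destruct (peval_bounded l) as [B [B0 HB]].
      (* Chosen so that [et |l| < c <= |q|] on the core outside the cylinder, so [q + et l] has no
         zero there. Inside, only [t] remains, where [q] vanishes and [l] does not. *)
      set (et := c / (2 * (B + 1))).
      assert (et0 : 0 < et) by (apply Rdiv_lt_0_compat; lra).
      assert (etB : et * B < c).
      { apply Rle_lt_trans with (et * (B + 1)); [apply Rmult_le_compat_l; lra|].
        replace (et * (B + 1)) with (c / 2) by (unfold et; field; lra). lra. }
      assert (qt : peval q (cpt t) = Czero).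
      { destruct (core_hits q Hq) as [s [Hs Hz]].
        destruct (classic (cylinder n s)) as [Cs|Cs].
        - rewrite <- (Iso s Hs Cs); exact Hz.
        - exfalso; apply M; exists s; auto. }
      destruct (core_hits (PAdd q (PMul (PConst (et, 0)) l))) as [s [Hs Hz]].
      { cbn [peval]. rewrite Hq, Hl0. unfold Cadd, Cmul, Czero; simpl; f_equal; ring. }
      cbn [peval] in Hz. destruct (classic (cylinder n s)) as [Cs|Cs].
      + rewrite (Iso s Hs Cs), qt in Hz. apply Hl1.
        assert (Z0 : Cmul (et, 0) (peval l (cpt t)) = Czero).
        { rewrite <- Hz. unfold Cadd, Czero; simpl; unfold Cmul; simpl; f_equal; ring. }
        apply Cmul_Czero in Z0; destruct Z0 as [Z0|Z0]; [|exact Z0].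
        injection Z0; lra.
      + specialize (Hc s (conj Hs Cs)).
        assert (Eq : Cmod (peval q (cpt s)) = et * Cmod (peval l (cpt s))).
        { rewrite <- (Cmod_real et) at 1 by lra. rewrite <- Cmod_Cmul.
          revert Hz. generalize (peval q (cpt s)) (Cmul (et, 0) (peval l (cpt s))).
          intros [a b] [c' d']. unfold Cadd, Czero, Cmod; simpl. intros H; injection H; intros.
          f_equal. replace a with (- c') by lra. replace b with (- d') by lra. ring. }
        specialize (HB s). assert (et * Cmod (peval l (cpt s)) <= et * B) by (apply Rmult_le_compat_l; lra).
        lra. }
  destruct E as [s [[H1 H2] H3]]. exists s; split; [split; [apply H1|exact H2]|exact H3].
Qed.

(** * Parametrizing a perfect closed set of binary sequences *)

Section PerfectSet.
Variable S0 : (nat -> bool) -> Prop.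
Hypothesis S0_closed : closed_set S0.
Hypothesis S0_perfect : forall t N, S0 t -> exists s, S0 s /\ agree N s t /\ s <> t.
Variable root : nat -> bool.
Hypothesis S0_root : S0 root.

(** [L'] is the first level from [L] on at which [S0] branches off [t]; between [L] and [L'] the
    prefix is forced. *)
Definition splits (t : nat -> bool) (L L' : nat) (t' : nat -> bool) : Prop :=
  (L <= L')%nat /\ S0 t' /\ agree L' t' t /\ t' L' <> t L' /\
  forall s, S0 s -> agree L s t -> agree L' s t.

Lemma splitting_exists t L : S0 t -> exists L' t', splits t L L' t'.
Proof.
  intros Ht.
  set (P := fun m => (L <= m)%nat /\ exists t', S0 t' /\ agree m t' t /\ t' m <> t m).
  assert (Ex : exists m, P m).
  { destruct (S0_perfect t L Ht) as [s [Hs [Ha Hn]]]. destruct (first_difference s t Hn) as [i [Hi Hd]].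
    exists i; split.
    - apply Nat.nlt_ge; intros C. apply Hd, Ha; exact C.
    - exists s; auto. }
  assert (Min : exists m, P m /\ forall k, (k < m)%nat -> ~ P k).
  { destruct Ex as [m Hm]. revert Hm. induction m as [m IH] using lt_wf_ind. intros Hm.
    destruct (classic (exists k, (k < m)%nat /\ P k)) as [[k [Hk HP]]|N]; [apply (IH k Hk HP)|].
    exists m; split; [exact Hm|intros k Hk HP; apply N; exists k; auto]. }
  destruct Min as [m [[Lm [t' [H1 [H2 H3]]]] Hmin]]. exists m, t'.
  split; [exact Lm|split; [exact H1|split; [exact H2|split; [exact H3|]]]].
  intros s Hs Ha. destruct (classic (s = t)) as [->|N]; [intros i Hi; reflexivity|].
  destruct (first_difference s t N) as [i [Hi Hd]].
  apply agree_le with (2 := Hi). apply Nat.nlt_ge; intros C. apply (Hmin i C). split.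
  - apply Nat.nlt_ge; intros D. apply Hd, Ha; exact D.
  - exists s; auto.
Qed.

(** A finite prefix occurring in [S0], encoded by its length and a full member of [S0] that carries
    it. *)
Definition node := {x : (nat -> bool) * nat | S0 (fst x)}.

Definition split_data (x : node) : {y : nat * (nat -> bool) |
    splits (fst (proj1_sig x)) (snd (proj1_sig x)) (fst y) (snd y)}.
Proof.
  apply constructive_indefinite_description.
  destruct (splitting_exists _ (snd (proj1_sig x)) (proj2_sig x)) as [L' [t' H]].
  exists (L', t'); exact H.
Defined.

Definition split_level (x : node) : nat := fst (proj1_sig (split_data x)).

Lemma child_in (x : node) (b : bool) :
  S0 (if Bool.eqb (fst (proj1_sig x) (split_level x)) b then fst (proj1_sig x) else snd (proj1_sig (split_data x))).
Proof.
  destruct Bool.eqb; [exact (proj2_sig x)|apply (proj2_sig (split_data x))].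
Qed.

Definition child (x : node) (b : bool) : node :=
  exist (fun y : (nat -> bool) * nat => S0 (fst y))
    ((if Bool.eqb (fst (proj1_sig x) (split_level x)) b then fst (proj1_sig x) else snd (proj1_sig (split_data x))),
     S (split_level x)) (child_in x b).

Definition branch (x : node) : nat -> bool := fst (proj1_sig x).
Definition level (x : node) : nat := snd (proj1_sig x).

Lemma child_level x b : level (child x b) = S (split_level x).
Proof. reflexivity. Qed.

Lemma split_level_ge x : (level x <= split_level x)%nat.
Proof. apply (proj2_sig (split_data x)). Qed.

Lemma child_agree x b : agree (split_level x) (branch (child x b)) (branch x).
Proof.
  unfold branch, child; simpl. destruct Bool.eqb; [intros i Hi; reflexivity|].
  destruct (proj2_sig (split_data x)) as [_ [_ [H _]]]; exact H.
Qed.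

Lemma child_bit x b : branch (child x b) (split_level x) = b.
Proof.
  unfold branch, child; simpl. destruct Bool.eqb eqn:E; [apply Bool.eqb_prop; exact E|].
  apply Bool.eqb_false_iff in E.
  destruct (proj2_sig (split_data x)) as [_ [_ [_ [H _]]]]. fold (split_level x) in H.
  destruct (snd (proj1_sig (split_data x)) (split_level x)), (fst (proj1_sig x) (split_level x)), b; congruence.
Qed.

Lemma node_agree_split x s : S0 s -> agree (level x) s (branch x) -> agree (split_level x) s (branch x).
Proof. apply (proj2_sig (split_data x)). Qed.

Fixpoint path (s : nat -> bool) (n : nat) : node :=
  match n with
  | O => exist (fun y : (nat -> bool) * nat => S0 (fst y)) (root, 0%nat) S0_root
  | S n => child (path s n) (s n)
  end.

Lemma path_level s n : (n <= level (path s n))%nat.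
Proof.
  induction n as [|n IH]; [lia|]. change (path s (S n)) with (child (path s n) (s n)).
  rewrite child_level. pose proof (split_level_ge (path s n)). lia.
Qed.

Lemma path_agree s n m : (n <= m)%nat ->
  (level (path s n) <= level (path s m))%nat /\
  agree (level (path s n)) (branch (path s m)) (branch (path s n)).
Proof.
  induction 1 as [|m H [IH1 IH2]]; [split; [lia|intros i Hi; reflexivity]|].
  change (path s (S m)) with (child (path s m) (s m)). rewrite child_level.
  pose proof (split_level_ge (path s m)). split; [lia|].
  apply agree_trans with (2 := IH2). apply agree_le with (2 := child_agree _ _). lia.
Qed.

(** The prefix settled at node [S i] has length at least [S i], so bit [i] no longer changes from
    there on. *)
Definition thread (s : nat -> bool) : nat -> bool := fun i => branch (path s (S i)) i.

Lemma thread_agree s n : agree (level (path s n)) (thread s) (branch (path s n)).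
Proof.
  intros i Hi. unfold thread. destruct (Nat.le_gt_cases (S i) n) as [H|H].
  - symmetry. apply (path_agree s (S i) n H). pose proof (path_level s (S i)); lia.
  - apply (path_agree s n (S i)); [lia|exact Hi].
Qed.

Lemma thread_in s : S0 (thread s).
Proof.
  apply S0_closed. intros n. exists (branch (path s n)); split.
  - exact (proj2_sig (path s n)).
  - apply agree_sym, agree_le with (2 := thread_agree s n). apply path_level.
Qed.

Lemma path_ext s s' n : agree n s s' -> path s n = path s' n.
Proof.
  induction n as [|n IH]; intros H; [reflexivity|]. simpl.
  rewrite IH by (apply agree_le with (2 := H); lia). rewrite H by lia. reflexivity.
Qed.

Lemma thread_continuous n s s' : agree n s s' -> agree n (thread s) (thread s').
Proof.
  intros H. apply agree_trans with (branch (path s n)).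
  - apply agree_le with (2 := thread_agree s n). apply path_level.
  - rewrite (path_ext s s' n H). apply agree_sym, agree_le with (2 := thread_agree s' n). apply path_level.
Qed.

Lemma thread_bit s n : thread s (split_level (path s n)) = s n.
Proof.
  rewrite (thread_agree s (S n)).
  - apply child_bit.
  - change (path s (S n)) with (child (path s n) (s n)). rewrite child_level; lia.
Qed.

Lemma thread_inj s s' : thread s = thread s' -> s = s'.
Proof.
  intros E. apply NNPP; intros N. destruct (first_difference s s' N) as [n [Ha Hd]].
  apply Hd. rewrite <- (thread_bit s n), <- (thread_bit s' n), (path_ext s s' n Ha), E. reflexivity.
Qed.

(** The inverse of [thread]: at each branching the bit of [t] tells which child to follow. *)
Fixpoint chase (t : nat -> bool) (n : nat) : node :=
  match n with
  | O => path t 0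
  | S n => child (chase t n) (t (split_level (chase t n)))
  end.

Lemma thread_surj t : S0 t -> exists s, thread s = t.
Proof.
  intros Ht. set (s := fun n => t (split_level (chase t n))). exists s.
  assert (E : forall n, path s n = chase t n).
  { induction n as [|n IH]; [reflexivity|]. simpl. rewrite IH. reflexivity. }
  assert (A : forall n, agree (level (chase t n)) t (branch (chase t n))).
  { induction n as [|n IH]; [intros i Hi; simpl in Hi; unfold level in Hi; simpl in Hi; lia|].
    intros i Hi. change (chase t (S n)) with (child (chase t n) (t (split_level (chase t n)))) in *.
    rewrite child_level in Hi. apply node_agree_split in IH; [|exact Ht].
    destruct (Nat.eq_dec i (split_level (chase t n))) as [->|Hne].
    - rewrite child_bit; reflexivity.
    - rewrite child_agree by lia. apply IH; lia. }
  extensionality i. assert (L := path_level s (S i)).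
  rewrite (thread_agree s (S i)) by lia. rewrite E in L |- *. symmetry; apply A; lia.
Qed.
End PerfectSet.

Lemma perfect_parametrization (S0 : (nat -> bool) -> Prop) : closed_set S0 ->
  (forall t N, S0 t -> exists s, S0 s /\ agree N s t /\ s <> t) -> (exists t, S0 t) ->
  exists h : (nat -> bool) -> (nat -> bool),
    (forall s, S0 (h s)) /\ (forall s s', h s = h s' -> s = s') /\
    (forall t, S0 t -> exists s, h s = t) /\
    (forall n s s', agree n s s' -> agree n (h s) (h s')).
Proof.
  intros Hc Hp [r Hr]. exists (thread S0 Hp r Hr).
  split; [|split; [|split]].
  - apply thread_in; exact Hc.
  - apply thread_inj.
  - apply thread_surj.
  - apply thread_continuous.
Qed.

(** * The image in complex space is a Cantor set *)

Lemma dist3_lim u l : cv3 u l -> is_lim_seq (fun n => dist3 l (u n)) 0.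
Proof.
  intros H. unfold dist3.
  assert (C : forall i, is_lim_seq (fun n => Cmod (Csub (coord i l) (coord i (u n))) ^ 2) 0).
  { intros i. replace 0 with (0 ^ 2) by ring. apply is_lim_seq_sqr.
    replace 0 with (Cmod (Csub (coord i l) (coord i l))) by (rewrite Csub_diag; apply Cmod_Czero).
    apply cvC_Cmod, cvC_sub; [apply cvC_const|apply H]. }
  replace 0 with (sqrt (0 + 0 + 0)) by (rewrite !Rplus_0_r; apply sqrt_0).
  apply (is_lim_seq_continuous sqrt (fun n => Cmod (Csub (coord 0 l) (coord 0 (u n))) ^ 2 +
     Cmod (Csub (coord 1 l) (coord 1 (u n))) ^ 2 + Cmod (Csub (coord 2 l) (coord 2 (u n))) ^ 2)).
  - apply continuity_pt_sqrt; lra.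
  - apply is_lim_seq_plus'; [apply is_lim_seq_plus'|]; apply C.
Qed.

Lemma Cmod_coord_le_dist3 i z w : Cmod (Csub (coord i z) (coord i w)) <= dist3 z w.
Proof.
  unfold dist3.
  pose proof (Cmod_ge0 (Csub (coord 0 z) (coord 0 w))); pose proof (Cmod_ge0 (Csub (coord 1 z) (coord 1 w)));
  pose proof (Cmod_ge0 (Csub (coord 2 z) (coord 2 w))).
  apply Rsqr_incr_0_var; [|apply sqrt_pos]. unfold Rsqr at 2. rewrite sqrt_sqrt by nra. unfold Rsqr.
  destruct i as [|[|i]]; simpl in *; nra.
Qed.

Lemma cv3_of_dist3 u l : is_lim_seq (fun n => dist3 l (u n)) 0 -> cv3 u l.
Proof.
  intros H i. apply cvC_of_Cmod. apply lim_squeeze0 with (2 := H). intros n; split; [apply Cmod_ge0|].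
  rewrite Cmod_Csub_sym. apply Cmod_coord_le_dist3.
Qed.

Lemma cv3_unique u a b : cv3 u a -> cv3 u b -> a = b.
Proof. intros Ha Hb. apply C3_ext. intros i; apply (cvC_unique (fun n => coord i (u n))); [apply Ha|apply Hb]. Qed.

Definition core_image (x : C3) : Prop := exists t, core t /\ cpt t = x.

Lemma core_nonempty : exists t, core t.
Proof. destruct (core_hits (PConst Czero) eq_refl) as [t [H _]]; exists t; exact H. Qed.

(** A continuous injection of a compact space has continuous inverse: a failure would give bit
    sequences with images tending to [x] and a cluster point different from [g x], against
    injectivity. *)
Lemma core_image_cantor : cantor_set core_image.
Proof.
  destruct (perfect_parametrization core core_closed core_perfect core_nonempty)
    as [h [Hin [Hinj [Hsur Hcont]]]].
  set (f := fun s => cpt (h s)).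
  assert (Ef : forall x, exists s, core_image x -> f s = x).
  { intros x. destruct (classic (core_image x)) as [[t [Ht <-]]|N].
    - destruct (Hsur t Ht) as [s <-]. exists s; reflexivity.
    (* Off the image the inverse takes an arbitrary default value. *)
    - exists (fun _ => true); contradiction. }
  set (g := fun x => proj1_sig (constructive_indefinite_description _ (Ef x))).
  assert (Hg : forall x, core_image x -> f (g x) = x)
    by (intros x; unfold g; destruct constructive_indefinite_description; assumption).
  assert (Hf : forall s, core_image (f s)) by (intros s; exists (h s); split; [apply Hin|reflexivity]).
  assert (Ff : forall s s', f s = f s' -> s = s') by (intros s s' E; apply Hinj, cpt_inj, E).
  assert (Fc : forall (T : nat -> nat -> bool) t, (forall n, agree (15 * n) (T n) t) -> cv3 (fun n => f (T n)) (f t)).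
  { intros T t H. apply (cpt_cv (fun n => h (T n)) (h t)). intros n; apply Hcont, H. }
  exists f, g. split; [exact Hf|split; [|split; [exact Hg|split]]].
  - intros s. apply Ff, Hg, Hf.
  - intros s e He. apply NNPP; intros C.
    assert (E : forall n : nat, exists t, agree (15 * n) t s /\ e <= dist3 (f s) (f t)).
    { intros n. apply NNPP; intros D. apply C. exists (15 * n)%nat. intros t Ht.
      apply Rnot_le_lt; intros Hd. apply D; exists t; split; [exact Ht|exact Hd]. }
    set (T := fun n => proj1_sig (constructive_indefinite_description _ (E n))).
    assert (HT : forall n, agree (15 * n) (T n) s /\ e <= dist3 (f s) (f (T n)))
      by (intros n; unfold T; destruct constructive_indefinite_description; assumption).
    assert (L := dist3_lim _ _ (Fc T s (fun n => proj1 (HT n)))).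
    assert (e <= 0); [|lra].
    apply (is_lim_seq_le (fun _ => e) (fun n => dist3 (f s) (f (T n))) e 0);
      [intros n; apply HT|apply is_lim_seq_const|exact L].
  - intros x Hx N. apply NNPP; intros C. set (s := g x).
    assert (Ex : f s = x) by (apply Hg; exact Hx).
    assert (E : forall n : nat, exists t, dist3 x (f t) < / (INR n + 1) /\ ~ agree N t s).
    { intros n. apply NNPP; intros D. apply C. exists (/ (INR n + 1)); split; [apply inv_S_pos|].
      intros y Hy Hd k Hk. apply NNPP; intros Hne. apply D. exists (g y); split.
      - rewrite Hg by exact Hy; exact Hd.
      - intros A; apply Hne, A; exact Hk. }
    set (T := fun n => proj1_sig (constructive_indefinite_description _ (E n))).
    assert (HT : forall n, dist3 x (f (T n)) < / (INR n + 1) /\ ~ agree N (T n) s)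
      by (intros n; unfold T; destruct constructive_indefinite_description; assumption).
    destruct (cpt_cluster T) as [r [t [Hr [Ha _]]]].
    assert (L1 := Fc (fun n => T (r n)) t Ha).
    assert (L2 : cv3 (fun n => f (T (r n))) x).
    { apply cv3_of_dist3.
      apply (is_lim_seq_comp_ge (fun n => dist3 x (f (T n))) 0 r Hr).
      apply lim_squeeze0 with (2 := is_lim_seq_inv_S). intros n; split; [apply sqrt_pos|left; apply HT]. }
    assert (Et : t = s) by (apply Ff; rewrite Ex; apply (cv3_unique _ _ _ L1 L2)).
    apply (proj2 (HT (r N))). rewrite <- Et. apply agree_le with (2 := Ha N); lia.
Qed.

(** * Inverses in the uniform algebra and density *)

Lemma Cmod_Cinv_half a : 1 / 2 <= fst a -> a <> Czero /\ Cmod (Cinv a) <= 2.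
Proof.
  intros H. assert (N : a <> Czero) by (intros ->; simpl in H; lra). split; [exact N|].
  pose proof (abs_fst_le a) as A. pose proof (Rle_abs (fst a)).
  assert (E : Cmod a * Cmod (Cinv a) = 1) by (rewrite <- Cmod_Cmul, (Cinv_right a N); apply Cmod_Cone).
  pose proof (Cmod_ge0 (Cinv a)). nra.
Qed.

(* Partial sums of the Neumann series of [1/f] with ratio [1 - f/m]. *)
Fixpoint neumann (f : poly3) (m : R) (n : nat) : poly3 :=
  match n with
  | O => PConst Czero
  | S n => PAdd (PMul (neumann f m n) (PAdd (PConst Cone) (PMul (PConst (/ m, 0)) (PMul (PConst (-1, 0)) f))))
                (PConst (/ m, 0))
  end.

Lemma neumann_error f m n z :
  Cmod (Csub Cone (Cmul (peval f z) (peval (neumann f m n) z))) =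
  Cmod (Cadd Cone (Cmul (/ m, 0) (Cmul (-1, 0) (peval f z)))) ^ n.
Proof.
  induction n as [|n IH]; cbn [neumann peval pow].
  - transitivity (Cmod Cone); [f_equal|apply Cmod_Cone].
    unfold Csub, Cmul, Cone, Czero; simpl; f_equal; ring.
  - rewrite <- IH, <- Cmod_Cmul. f_equal.
    generalize (peval f z) (peval (neumann f m n) z). intros [a b] [c d].
    unfold Csub, Cadd, Cmul, Cone; simpl; f_equal; ring.
Qed.

(** The half-plane contraction applied to [-f] gives [|1 - f/m| <= r < 1] on [X], so [E] times the
    Neumann sums approximates [E/f] with error at most [2 B r^n]. *)
Lemma in_PX_quotient (X : C3 -> Prop) f E B : (forall x, X x -> 1 / 2 <= fst (peval f x)) ->
  (forall x, X x -> Cmod (peval f x) <= B) -> (forall x, X x -> Cmod (peval E x) <= B) -> 0 <= B ->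
  in_PX X (fun x => Cmul (peval E x) (Cinv (peval f x))).
Proof.
  intros Hf HB HE B0 e He.
  destruct (half_plane_contraction B B0) as [m [r [m0 [Hr Hc]]]].
  destruct (pow_small r (e / (2 * B + 1))) as [n Hn]; [exact Hr|apply Rdiv_lt_0_compat; lra|].
  exists (PMul E (neumann f m n)). intros x Hx. cbn [peval].
  destruct (Cmod_Cinv_half _ (Hf x Hx)) as [N I2].
  specialize (Hf x Hx); specialize (HB x Hx); specialize (HE x Hx).
  pose proof (neumann_error f m n x) as Err.
  assert (Hq : Cmod (Csub Cone (Cmul (peval f x) (peval (neumann f m n) x))) <= r ^ n).
  { rewrite Err. apply pow_incr; split; [apply Cmod_ge0|]. apply Hc.
    - simpl; lra.
    - rewrite Cmod_Cmul. replace (Cmod (-1, 0)) with 1; [lra|].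
      unfold Cmod; simpl. replace (-1 * (-1 * 1) + 0 * (0 * 1)) with 1 by ring. symmetry; apply sqrt_1. }
  replace (Csub (Cmul (peval E x) (Cinv (peval f x))) (Cmul (peval E x) (peval (neumann f m n) x)))
    with (Cmul (Cmul (peval E x) (Cinv (peval f x))) (Csub Cone (Cmul (peval f x) (peval (neumann f m n) x)))).
  - rewrite !Cmod_Cmul.
    assert (P : Cmod (peval E x) * Cmod (Cinv (peval f x)) <= 2 * B).
    { rewrite (Rmult_comm 2). apply Rmult_le_compat; auto using Cmod_ge0. }
    apply Rle_lt_trans with ((2 * B) * r ^ n).
    + apply Rmult_le_compat; auto using Cmod_ge0. apply Rmult_le_pos; apply Cmod_ge0.
    + apply Rle_lt_trans with ((2 * B + 1) * r ^ n).
      * assert (0 <= r ^ n) by (apply pow_le; lra). nra.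
      * apply Rlt_le_trans with ((2 * B + 1) * (e / (2 * B + 1))).
        -- apply Rmult_lt_compat_l; lra.
        -- apply Req_le; field; lra.
  - transitivity (Csub (Cmul (peval E x) (Cinv (peval f x)))
      (Cmul (peval E x) (Cmul (Cmul (peval f x) (Cinv (peval f x))) (peval (neumann f m n) x)))).
    + generalize (peval E x) (Cinv (peval f x)) (peval f x) (peval (neumann f m n) x).
      intros [a1 a2] [b1 b2] [c1 c2] [d1 d2]. unfold Csub, Cmul, Cone; simpl; f_equal; ring.
    + rewrite (Cinv_right _ N), Cmul_one; reflexivity.
Qed.

Lemma poly_in_PX X p : in_PX X (peval p).
Proof. intros e He; exists p; intros x _. rewrite Csub_diag, Cmod_Czero; exact He. Qed.

(** The enumerated polynomial divides [peak (S n)], whose real part is at least [1/2] on the core;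
    its inverse is the cofactor [E] divided by that peak. *)
Lemma enum_invertible n : peval (poly_enum n) base_point <> Czero ->
  invertible_PX core_image (peval (poly_enum n)).
Proof.
  intros H. destruct (peak_succ n) as [_ K]. destruct (K H) as [E HE].
  split; [apply poly_in_PX|].
  assert (Hf : forall x, core_image x -> 1 / 2 <= fst (peval (peak (S n)) x)).
  (* At index 0 membership in the core is membership in [peak_set]. *)
  { intros x [t [Ht <-]]. apply (Ht 0%nat). }
  exists (fun x => Cmul (peval E x) (Cinv (peval (peak (S n)) x))). split.
  - destruct (peval_bounded E) as [B1 [B10 H1]]. destruct (peval_bounded (peak (S n))) as [B2 [B20 H2]].
    apply in_PX_quotient with (B1 + B2); [exact Hf| | |lra]; intros x [t [_ <-]].
    + specialize (H2 t); lra.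
    + specialize (H1 t); lra.
  - intros x Hx. rewrite Cmul_assoc, <- HE. apply Cinv_right. apply Cmod_Cinv_half, Hf, Hx.
Qed.

Theorem theorem1p4 :
  exists X : C3 -> Prop,
    cantor_set X /\
    (exists z : C3, poly_hull X z /\ ~ X z) /\
    dense_invertibles_PX X.
Proof.
  exists core_image. split; [exact core_image_cantor|split].
  - exists base_point; split.
    + intros p M HM.
      destruct (core_hits (PAdd p (PConst (Csub Czero (peval p base_point))))) as [t [Ht Hz]].
      { cbn [peval]. unfold Cadd, Csub, Czero; simpl; f_equal; ring. }
      cbn [peval] in Hz.
      assert (E : peval p base_point = peval p (cpt t)).
      { revert Hz. generalize (peval p (cpt t)) (peval p base_point). intros [a b] [c d].
        unfold Cadd, Csub, Czero; simpl. intros H; injection H; intros; f_equal; lra. }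
      rewrite E. apply HM. exists t; auto.
    + intros [t [_ Ht]]. exact (base_point_not_cpt t Ht).
  - intros f Hf e He.
    destruct (Hf (e / 4)) as [p Hp]; [lra|].
    (* The region of approximation must include [base_point], where nonvanishing has to be
       preserved. *)
    destruct cpt_bounded as [M HM]. set (M' := Rmax M (size3 base_point)).
    assert (Ep : exists p', peval p' base_point <> Czero /\
      forall z, Cmod (Csub (peval p z) (peval p' z)) <= e / 4).
    { destruct (classic (peval p base_point = Czero)) as [E|E].
      - exists (PAdd p (PConst (e / 4, 0))); split.
        + cbn [peval]; rewrite E. intros C; injection C; lra.
        + intros z; cbn [peval]. rewrite Cmod_Csub_sym.
          replace (Csub (Cadd (peval p z) (e / 4, 0)) (peval p z)) with (e / 4, 0)
            by (unfold Csub, Cadd; simpl; f_equal; ring).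
          rewrite Cmod_real; lra.
      - exists p; split; [exact E|]. intros z; rewrite Csub_diag, Cmod_Czero; lra. }
    destruct Ep as [p' [Hp0 Hpp]]. pose proof (Cmod_pos _ Hp0) as P0.
    (* The second bound keeps the enumerated polynomial nonzero at [base_point]; the first leaves a
       total error below [3 e / 4]. *)
    destruct (poly_enum_dense M' p' (Rmin (e / 4) (Cmod (peval p' base_point) / 2))) as [n Hn].
    { apply Rmin_glb_lt; lra. }
    assert (Hn1 : forall z, size3 z <= M' -> Cmod (Csub (peval (poly_enum n) z) (peval p' z)) <= e / 4)
      by (intros z Hz; eapply Rle_trans; [apply (Hn z Hz)|apply Rmin_l]).
    assert (Hn2 : peval (poly_enum n) base_point <> Czero).
    { intros C. pose proof (Hn base_point (Rmax_r _ _)) as D. rewrite C, Cmod_Csub_sym in D.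
      replace (Csub (peval p' base_point) Czero) with (peval p' base_point) in D
        by (destruct (peval p' base_point); unfold Csub, Czero; simpl; f_equal; ring).
      pose proof (Rmin_r (e / 4) (Cmod (peval p' base_point) / 2)). lra. }
    exists (peval (poly_enum n)); split; [apply enum_invertible; exact Hn2|].
    intros x Hx. specialize (Hp x Hx). specialize (Hpp x).
    assert (Hn3 : Cmod (Csub (peval (poly_enum n) x) (peval p' x)) <= e / 4).
    { apply Hn1. destruct Hx as [t [_ <-]]. eapply Rle_trans; [apply HM|apply Rmax_l]. }
    rewrite Cmod_Csub_sym in Hn3.
    replace (Csub (f x) (peval (poly_enum n) x))
      with (Cadd (Csub (f x) (peval p x)) (Cadd (Csub (peval p x) (peval p' x)) (Csub (peval p' x) (peval (poly_enum n) x))))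
      by (unfold Csub, Cadd; simpl; f_equal; ring).
    eapply Rle_lt_trans; [apply Cmod_Cadd|].
    pose proof (Cmod_Cadd (Csub (peval p x) (peval p' x)) (Csub (peval p' x) (peval (poly_enum n) x))). lra.
Qed.
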